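(* Let $(\Omega,\mu)$ be a probability measure space. Let $K:\Omega\times\Omega\to\mathbb{R}$ be a measurable positive definite kernel such that $K(t,t)\le 1$ for all $t\in\Omega$. Then for any $r\in\mathbb{N}$, there exists a partition $\Omega=I_1\cup\cdots\cup I_k$ into (measurable) sets with $k\le 2^r$, and a function $L:\Omega\times\Omega\to\mathbb{R}$ that is constant on each block $I_i\times I_j$, such that $$\|K-L\|_{L^2(\mu\times\mu)}\le\frac{\pi}{\sqrt r}.$$ Moreover, $L$ can be computed by averaging $K$ on each block, i.e. one can take $L$ equal on $I_i\times I_j$ to $\frac{1}{\mu(I_i)\mu(I_j)}\int_{I_i\times I_j}K\,d(\mu\times\mu)$ whenever $\mu(I_i)\mu(I_j)>0$ (the constant value on blocks of measure zero being immaterial).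
   Context: $\mathbb{N}=\{1,2,3,\dots\}$. A kernel $K:\Omega\times\Omega\to\mathbb{R}$ is positive definite if it is symmetric and for every $m\in\mathbb{N}$ and all $t_1,\dots,t_m\in\Omega$ the matrix $[K(t_i,t_j)]_{i,j=1}^m$ is positive semidefinite. Measurability of $K$ is with respect to the product $\sigma$-algebra on $\Omega\times\Omega$. The norm is $\|R\|_{L^2(\mu\times\mu)}=\big(\int_{\Omega\times\Omega}R(x,y)^2\,d\mu(x)\,d\mu(y)\big)^{1/2}$. *)

(* Defs.v *)
From HB Require Import structures.
From mathcomp Require Import all_boot all_order all_algebra.
From mathcomp Require Import all_classical all_reals all_analysis.

Set Implicit Arguments.
Unset Strict Implicit.
Unset Printing Implicit Defensive.
Import Order.TTheory GRing.Theory Num.Theory.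
Local Open Scope classical_set_scope.
Local Open Scope ring_scope.

Definition psdmx (R : realType) (m : nat) (A : 'M[R]_m) : Prop :=
  A^T = A /\ forall v : 'cV[R]_m, 0 <= (v^T *m A *m v) ord0 ord0.

Definition positive_definite_kernel (R : realType) (T : Type)
    (K : T * T -> R) : Prop :=
  (forall s t : T, K (s, t) = K (t, s)) /\
  (forall (m : nat) (t : 'I_m -> T), (0 < m)%N ->
     psdmx (\matrix_(i < m, j < m) K (t i, t j))).

Definition block_constant (R : realType) (T : Type) (k : nat)
    (I : 'I_k -> set T) (L : T * T -> R) : Prop :=
  forall i j : 'I_k, exists c : R, forall z, (I i `*` I j) z -> L z = c.

(* The values of [L] on blocks of measure zero are left unconstrained. *)
Definition averages_on_blocks (R : realType) (d : measure_display)
    (T : measurableType d) (mu : probability T R) (k : nat)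
    (I : 'I_k -> set T) (K L : T * T -> R) : Prop :=
  forall i j : 'I_k, (0 < mu (I i) * mu (I j))%E ->
    forall z, (I i `*` I j) z ->
      L z = (\int[(mu \x mu)%E]_(w in I i `*` I j) K w)
            / fine (mu (I i) * mu (I j))%E.

(* Main.v *)
Require Import Defs.
From HB Require Import structures.
From mathcomp Require Import all_boot all_order all_algebra.
From mathcomp Require Import all_classical all_reals all_analysis.
From mathcomp Require Import measurable_realfun zify ring lra.

(* Approximate [K] in L^2 by a finite-rank kernel <e(x), e(y)> (greedy pivoted
   Cholesky; the trace bounds the number of steps) and complete e(x) to unit
   vectors u(x), v(x), in different directions, so that
   <u(x), v(y)> = <e(x), e(y)> for all x, y.  Let G be a finitely supported
   approximation of a standard Gaussian vector and [wave] an odd trigonometric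
   polynomial bounded by 1.  The expectation of wave <u, G> * wave <v, G> is
   nearly a function [wave_corr] of <u, v>, whose inverse is Lipschitz with
   constant at most 25/12.  Rounding both factors to signs with independent
   random thresholds keeps the expectation, so that [wave_corr <u(x), v(y)>]
   is an average of products s(x) t(y) of signs.  A greedy choice of m = floor(r/2)
   such products (two bits for each) has an average within about m^(-1/2) of
   it in L^2, and applying the inverse of [wave_corr] gives a block-constant
   approximation of [K] with error at most (25/12) m^(-1/2) up to small
   terms, which is below pi / sqrt r as soon as r >= 10.  For r <= 9 the
   trivial partition works since |K| <= 1.  Averaging over blocks is the best
   L^2 approximation by block-constant functions. *)

Set Implicit Arguments.
Unset Strict Implicit.
Unset Printing Implicit Defensive.
Import Order.TTheory GRing.Theory Num.Theory.
Local Open Scope classical_set_scope.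
Local Open Scope ring_scope.
Import numFieldNormedType.Exports.

(** * Elementary bounds *)

Section real_bounds.
Context {R : realType}.
Implicit Types (f df : R -> R) (x y z : R).

(** Drives the alternating Taylor bounds below: the derivative of each difference is nonnegative by
    the preceding bound of the chain. *)
Lemma le_of_derive_ge0 f df x : (forall y, is_derive y (1 : R) f (df y)) ->
  (forall y, 0 <= y -> 0 <= df y) -> 0 <= x -> f 0 <= f x.
Proof.
move=> fdf df0 x0.
have fc : {within `[0, x], continuous f}.
  apply: continuous_subspaceT => y; apply: differentiable_continuous.
  by apply/derivable1_diffP; have [] := fdf y.
have [c + e] := MVT_segment x0 (fun y _ => fdf y) fc.
rewrite in_itv/= => /andP[c0 _].
by rewrite -subr_ge0 e subr0 mulr_ge0// df0.
Qed.

Lemma sin_le x : 0 <= x -> sin x <= x.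
Proof.
move=> x0; suff : 0 - sin 0 <= x - sin x by rewrite sin0; lra.
apply: (@le_of_derive_ge0 (fun y => y - sin y) (fun y => 1 - cos y)) => //.
Qed.

Lemma is_derive_powM (c : R) n y :
  is_derive y (1 : R) (fun x : R => c * x ^+ n.+1) (n.+1%:R * c * y ^+ n).
Proof.
rewrite (_ : (fun x => _) = c \*: (id ^+ n.+1)); last first.
  by apply/funext => x /=; rewrite exprfctE.
apply: (is_derive_eq (is_deriveZ c (is_deriveX n.+1 (is_derive_id y (1 : R))))).
by rewrite /GRing.scale/= mulr1; ring.
Qed.

Lemma cos_ge2 x : 0 <= x -> 1 - x ^+ 2 / 2 <= cos x.
Proof.
move=> x0; pose f y := cos y - 1 + 2^-1 * y ^+ 2.
pose df y : R := y - sin y.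
suff : f 0 <= f x by rewrite /f cos0; lra.
apply: (@le_of_derive_ge0 f df _ _ _ x0) => y.
  rewrite /f; apply: (is_derive_eq
    (is_deriveD (is_deriveB (is_derive_cos y) (is_derive_cst (1 : R) y (1 : R)))
      (is_derive_powM _ 1 y))).
  by rewrite /df; field.
by move=> /sin_le; rewrite /df; lra.
Qed.

Lemma sin_ge3 x : 0 <= x -> x - x ^+ 3 / 6 <= sin x.
Proof.
move=> x0; pose f y := sin y - y + 6^-1 * y ^+ 3.
pose df y : R := cos y - (1 - y ^+ 2 / 2).
suff : f 0 <= f x by rewrite /f sin0; lra.
apply: (@le_of_derive_ge0 f df _ _ _ x0) => y.
  rewrite /f; apply: (is_derive_eq
    (is_deriveD (is_deriveB (is_derive_sin y) (is_derive_id y (1 : R)))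
      (is_derive_powM _ 2 y))).
  by rewrite /df; field.
by move=> /cos_ge2; rewrite /df; lra.
Qed.

Lemma cos_le4 x : 0 <= x -> cos x <= 1 - x ^+ 2 / 2 + x ^+ 4 / 24.
Proof.
move=> x0; pose f y := 1 - 2^-1 * y ^+ 2 + 24^-1 * y ^+ 4 - cos y.
pose df y : R := sin y - (y - y ^+ 3 / 6).
suff : f 0 <= f x by rewrite /f cos0; lra.
apply: (@le_of_derive_ge0 f df _ _ _ x0) => y.
  rewrite /f; apply: (is_derive_eq
    (is_deriveB (is_deriveD (is_deriveB (is_derive_cst (1 : R) y (1 : R))
      (is_derive_powM _ 1 y)) (is_derive_powM _ 3 y)) (is_derive_cos y))).
  by rewrite /df; field.
by move=> /sin_ge3; rewrite /df; lra.
Qed.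

Lemma sin_le5 x : 0 <= x -> sin x <= x - x ^+ 3 / 6 + x ^+ 5 / 120.
Proof.
move=> x0; pose f y := y - 6^-1 * y ^+ 3 + 120^-1 * y ^+ 5 - sin y.
pose df y : R := 1 - y ^+ 2 / 2 + y ^+ 4 / 24 - cos y.
suff : f 0 <= f x by rewrite /f sin0; lra.
apply: (@le_of_derive_ge0 f df _ _ _ x0) => y.
  rewrite /f; apply: (is_derive_eq
    (is_deriveB (is_deriveD (is_deriveB (is_derive_id y (1 : R))
      (is_derive_powM _ 2 y)) (is_derive_powM _ 4 y)) (is_derive_sin y))).
  by rewrite /df; field.
by move=> /cos_le4; rewrite /df; lra.
Qed.

Lemma cos_ge6 x : 0 <= x ->
  1 - x ^+ 2 / 2 + x ^+ 4 / 24 - x ^+ 6 / 720 <= cos x.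
Proof.
move=> x0.
pose f y := cos y - 1 + 2^-1 * y ^+ 2 - 24^-1 * y ^+ 4 + 720^-1 * y ^+ 6.
pose df y : R := y - y ^+ 3 / 6 + y ^+ 5 / 120 - sin y.
suff : f 0 <= f x by rewrite /f cos0; lra.
apply: (@le_of_derive_ge0 f df _ _ _ x0) => y.
  rewrite /f; apply: (is_derive_eq
    (is_deriveD (is_deriveB (is_deriveD (is_deriveB (is_derive_cos y)
      (is_derive_cst (1 : R) y (1 : R))) (is_derive_powM _ 1 y))
      (is_derive_powM _ 3 y)) (is_derive_powM _ 5 y))).
  by rewrite /df; field.
by move=> /sin_le5; rewrite /df; lra.
Qed.

(** [cos] vanishes at [pi / 2], while its degree-6 lower bound is still positive on [1, 31/20]. *)
Lemma pi_ge31 : 31 / 10 <= pi :> R.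
Proof.
have := @pihalf_lt2 R; have := @pihalf_ge1 R => pi1 pi2.
have := @cos_pihalf R; set h := pi / 2 in pi1 pi2 *; move=> ch.
suff : 31 / 20 <= h by rewrite /h; lra.
have := @cos_ge6 h; rewrite ch => /(_ _).
have h0 : 0 <= h by lra.
move=> /(_ h0) H; rewrite leNgt; apply/negP => hl.
have : 0 <= h ^+ 2 <= 961 / 400 by rewrite !exprS expr0; nra.
set t := h ^+ 2 in H * => /andP[t0 tl].
have h4 : h ^+ 4 = t ^+ 2 by rewrite /t -exprM.
have h6 : h ^+ 6 = t ^+ 3 by rewrite /t -exprM.
move: H; rewrite h4 h6 !exprS expr0 => H.
nra.
Qed.

Lemma is_derive_expRN y :
  is_derive y (1 : R) (fun x : R => expR (- x)) (- expR (- y)).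
Proof. by apply: is_derive_eq; rewrite /GRing.scale/=; ring. Qed.

Lemma expRN_le2 x : 0 <= x -> expR (- x) <= 1 - x + x ^+ 2 / 2.
Proof.
move=> x0; pose f y := 1 - y + 2^-1 * y ^+ 2 - expR (- y).
pose df y : R := - 1 + y + expR (- y).
suff : f 0 <= f x by rewrite /f oppr0 expR0; lra.
apply: (@le_of_derive_ge0 f df _ _ _ x0) => y.
  rewrite /f; apply: (is_derive_eq
    (is_deriveB (is_deriveD (is_deriveB (is_derive_cst (1 : R) y (1 : R))
      (is_derive_id y (1 : R))) (is_derive_powM _ 1 y)) (is_derive_expRN y))).
  by rewrite /df; field.
by move=> _; have := expR_ge1Dx (- y); rewrite /df; lra.
Qed.

Lemma expRN_ge3 x : 0 <= x -> 1 - x + x ^+ 2 / 2 - x ^+ 3 / 6 <= expR (- x).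
Proof.
move=> x0; pose f y := expR (- y) - 1 + y - 2^-1 * y ^+ 2 + 6^-1 * y ^+ 3.
pose df y : R := 1 - y + y ^+ 2 / 2 - expR (- y).
suff : f 0 <= f x by rewrite /f oppr0 expR0; lra.
apply: (@le_of_derive_ge0 f df _ _ _ x0) => y.
  rewrite /f; apply: (is_derive_eq
    (is_deriveD (is_deriveB (is_deriveD (is_deriveB (is_derive_expRN y)
      (is_derive_cst (1 : R) y (1 : R))) (is_derive_id y (1 : R)))
      (is_derive_powM _ 1 y)) (is_derive_powM _ 2 y))).
  by rewrite /df; field.
by move=> /expRN_le2; rewrite /df; lra.
Qed.

Lemma expRN1_ge : 365 / 1000 <= expR (- 1) :> R.
Proof.
(* At 1 the cubic bound gives only 1/3; at 1/2 it gives 29/48, whose square exceeds 365/1000. *)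
have -> : - 1 = - (1 / 2) - (1 / 2) :> R by lra.
have := @expRN_ge3 (1 / 2); rewrite expRD => /(_ _).
have h : 0 <= 1 / 2 :> R by lra.
move=> /(_ h); rewrite !exprS expr0; nra.
Qed.

Lemma double_le_expRBN x : 0 <= x -> 2 * x <= expR x - expR (- x).
Proof.
move=> x0; suff : expR 0 - expR (- 0) - 2 * 0 <= expR x - expR (- x) - 2 * x.
  by rewrite oppr0; lra.
apply: (@le_of_derive_ge0 (fun y => expR y - expR (- y) - 2 * y)
  (fun y => expR y + expR (- y) - 2)) => // y.
  by apply: is_derive_eq; rewrite /GRing.scale/=; ring.
by move=> _; have := expR_ge1Dx (- y); have := expR_ge1Dx y; lra.
Qed.

Lemma sinh_increment x y : y <= x ->
  2 * (x - y) <= (expR x - expR (- x)) - (expR y - expR (- y)).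
Proof.
(* In midpoint and half-difference the increment factors as (e^s + e^-s)(e^t - e^-t), with first
   factor at least 2. *)
move=> yx; set s := (x + y) / 2; set t := (x - y) / 2.
have t0 : 0 <= t by rewrite /t; lra.
have -> : x = s + t by rewrite /s /t; lra.
have -> : y = s - t by rewrite /s /t; lra.
rewrite !opprD opprK !expRD.
have := double_le_expRBN t0.
have := expR_ge1Dx s; have := expR_ge1Dx (- s).
set a := expR s; set b := expR (- s); set c := expR t; set d := expR (- t).
move=> h1 h2 h3.
have : (a + b) * (c - d) >= 2 * (c - d) by nra.
lra.
Qed.

(** Compares the characteristic functions of a random sign and of a standard Gaussian: they agree
    through second order, and a fourth-order error is what a central limit argument needs. *)
Lemma cos_expR_dist x : `|cos x - expR (- (x ^+ 2 / 2))| <= x ^+ 4.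
Proof.
rewrite -(cos_norm x) -(real_normK (num_real x)).
have -> : x ^+ 4 = `|x| ^+ 4 by rewrite -normrX ger0_norm// exprn_even_ge0.
move: (normr_ge0 x); move: `|x| => {}x x0.
have h := expR_ge1Dx (- (x ^+ 2 / 2)).
have x2 : 0 <= x ^+ 2 / 2 by have := sqr_ge0 x; lra.
have := expRN_le2 x2; have := cos_ge2 x0; have := cos_le4 x0.
have -> : (x ^+ 2 / 2) ^+ 2 / 2 = x ^+ 4 / 8 by field.
have : 0 <= x ^+ 4 by rewrite exprn_ge0.
by move=> *; rewrite ler_norml; apply/andP; split; lra.
Qed.

End real_bounds.

(** * One-bit random features *)

Section finite_average.
Context {R : realType}.

(** Expectation under the uniform law; all random choices are drawn from finite types. *)
Definition favg (W : finType) (f : W -> R) : R := (\sum_a f a) / #|W|%:R.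

Lemma favgD (W : finType) (f g : W -> R) :
  favg (fun a => f a + g a) = favg f + favg g.
Proof. by rewrite /favg big_split mulrDl. Qed.

Lemma favgZ (W : finType) (c : R) (f : W -> R) :
  favg (fun a => c * f a) = c * favg f.
Proof. by rewrite /favg -mulr_sumr mulrA. Qed.

Lemma eq_favg (W : finType) (f g : W -> R) : f =1 g -> favg f = favg g.
Proof. by move=> fg; rewrite /favg (eq_bigr _ (fun a _ => fg a)). Qed.

Lemma favg_cst (W : finType) (c : R) : (0 < #|W|)%N -> favg (fun _ : W => c) = c.
Proof.
move=> W0; rewrite /favg sumr_const -[c *+ _]mulr_natr mulfK//.
by rewrite pnatr_eq0 -lt0n.
Qed.

Lemma favg_pair (V W : finType) (f : V -> W -> R) :
  favg (fun p : V * W => f p.1 p.2) = favg (fun a => favg (f a)).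
Proof.
rewrite /favg card_prod natrM invfM -(pair_bigA _ f)/= -mulr_suml.
by rewrite -mulrA [X in _ * X]mulrC.
Qed.

Lemma le_favg (W : finType) (f g : W -> R) :
  (forall a, f a <= g a) -> favg f <= favg g.
Proof. by move=> fg; rewrite /favg ler_wpM2r// ler_sum. Qed.

Lemma ler_norm_favg (W : finType) (f : W -> R) :
  `|favg f| <= favg (fun a => `|f a|).
Proof.
rewrite /favg normrM normfV (ger0_norm (ler0n _ _)).
by rewrite ler_wpM2r ?invr_ge0// ler_norm_sum.
Qed.

Lemma favg_norm_le (W : finType) (f : W -> R) (c : R) : (0 < #|W|)%N ->
  (forall a, `|f a| <= c) -> `|favg f| <= c.
Proof.
move=> W0 fc; rewrite (le_trans (ler_norm_favg f))//.
by rewrite -[leRHS](favg_cst c W0) le_favg.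
Qed.

(** Factors are exchanged one at a time; the remaining ones have modulus at most 1. *)
Lemma dist_prod_le n (f g : nat -> R) (c : R) :
  (forall i, `|f i| <= 1) -> (forall i, `|g i| <= 1) ->
  (forall i, `|f i - g i| <= c) ->
  `|\prod_(i < n) f i - \prod_(i < n) g i| <= n%:R * c.
Proof.
move=> f1 g1 fg; elim: n => [|n IHn].
  by rewrite !big_ord0 subrr normr0 mul0r.
rewrite !big_ord_recr/=.
set p := \prod_(i < n) f i in IHn *; set q := \prod_(i < n) g i in IHn *.
have q1 : `|q| <= 1.
  rewrite /q normr_prod numdomain.Num.Theory.prodr_ile1// => i _.
  by rewrite normr_ge0 g1.
have -> : p * f n - q * g n = (p - q) * f n + q * (f n - g n) by ring.
rewrite (le_trans (ler_normD _ _))// !normrM.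
rewrite -natr1 mulrDl mul1r lerD//.
  by rewrite -[leRHS]mulr1 ler_pM.
by rewrite -[leRHS]mul1r ler_pM.
Qed.

End finite_average.

(** * Finitely supported approximations of Gaussian vectors *)

Section almost_gaussian.
Context {R : realType}.

Definition bsign (b : bool) : R := if b then 1 else - 1.

Lemma favg_bsign_cos (t w : R) :
  favg (fun b => cos (t + w * bsign b)) = cos t * cos w.
Proof.
rewrite /favg big_bool card_bool /bsign/= mulr1 mulrN1 cosB cosD.
by field.
Qed.

(** The hypothesis says that [G] has the real characteristic function [phi]. The free phase [t]
    carries the induction: while the last copy is averaged, the sum over the earlier ones is part of
    the phase. *)
Lemma iid_copies (W : finType) (G : W -> R) (phi : R -> R) (n : nat) :
  (0 < #|W|)%N ->
  (forall t w, favg (fun a => cos (t + w * G a)) = cos t * phi w) ->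
  exists (V : finType) (H : V -> nat -> R), (0 < #|V|)%N /\
    forall t (w : nat -> R),
      favg (fun a => cos (t + \sum_(i < n) w i * H a i)) =
      cos t * \prod_(i < n) phi (w i).
Proof.
move=> W0 hG; elim: n => [|n [V [H [V0 hH]]]].
  exists unit, (fun _ _ => 0); rewrite card_unit; split => // t w.
  rewrite big_ord0 mulr1 -[RHS](@favg_cst _ unit) ?card_unit//.
  by apply: eq_favg => a; rewrite big_ord0 addr0.
exists (V * W)%type, (fun p i => if i == n then G p.2 else H p.1 i).
rewrite card_prod muln_gt0 V0 W0; split=> // t w.
under eq_favg => p.
  rewrite big_ord_recr/= eqxx.
  under eq_bigr => i _ do rewrite (ltn_eqF (ltn_ord i)).
  rewrite addrA. over.
rewrite (favg_pair (fun a b => cos (t + \sum_(i < n) w i * H a i + w n * G b))).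
under eq_favg do rewrite hG mulrC.
by rewrite favgZ hH big_ord_recr/=; ring.
Qed.

(** A quantitative central limit theorem for [N] random signs scaled by 1 / sqrt N, whose
    characteristic function is cos(w / sqrt N)^N. *)
Lemma almost_gaussian (B e : R) : 0 < e ->
  exists (W : finType) (G : W -> R) (phi : R -> R), [/\ (0 < #|W|)%N,
    forall t w, favg (fun a => cos (t + w * G a)) = cos t * phi w,
    forall w, `|phi w| <= 1 &
    forall w, `|w| <= B -> `|phi w - expR (- (w ^+ 2 / 2))| <= e].
Proof.
move=> e0.
(* Each of the [N] factors errs by at most w^4 / N^2, so the total error is at most B^4 / N. *)
pose N := (Num.trunc (B ^+ 4 / e)).+1.
have NB : B ^+ 4 / e < N%:R by exact: truncnS_gt.
have b0 : (0 < #|{: bool}|)%N by rewrite card_bool.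
have [V [H [V0 hH]]] := iid_copies N b0 favg_bsign_cos.
have N0 : 0 < N%:R :> R by rewrite ltr0n.
exists V, (fun a => \sum_(i < N) (Num.sqrt N%:R)^-1 * H a i),
  (fun w => cos (w / Num.sqrt N%:R) ^+ N).
split=> //.
- move=> t w; under eq_favg.
    move=> a; rewrite mulr_sumr; under eq_bigr do rewrite mulrA.
    over.
  by rewrite (hH t (fun=> w / Num.sqrt N%:R)) prodr_const card_ord.
- by move=> w; rewrite normrX exprn_ile1// cos_max.
- move=> w wB; set y := w / Num.sqrt N%:R.
  have -> : expR (- (w ^+ 2 / 2)) = expR (- (y ^+ 2 / 2)) ^+ N.
    rewrite -expRM_natl; congr expR.
    rewrite /y exprMn exprVn sqr_sqrtr ?(ltW N0)//.
    by field; rewrite gt_eqF.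
  have := @dist_prod_le R N (fun=> cos y) (fun=> expR (- (y ^+ 2 / 2))) (y ^+ 4).
  rewrite !prodr_const card_ord => /(_ (fun=> cos_max _) _ (fun=> cos_expR_dist _)).
  have h (i : nat) : `|expR (- (y ^+ 2 / 2))| <= 1.
    by rewrite ger0_norm ?expR_ge0// expR_le1 oppr_le0 divr_ge0// sqr_ge0.
  move=> /(_ h) /le_trans; apply.
  rewrite /y exprMn exprVn (_ : Num.sqrt N%:R ^+ 4 = N%:R ^+ 2); last first.
    by rewrite (exprM _ 2 2) sqr_sqrtr// ltW.
  have -> : N%:R * (w ^+ 4 / N%:R ^+ 2) = w ^+ 4 / N%:R.
    by field; rewrite gt_eqF.
  rewrite ler_pdivrMr// mulrC -ler_pdivrMr// (le_trans _ (ltW NB))//.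
  rewrite ler_pM2r ?invr_gt0//.
  have -> : w ^+ 4 = `|w| ^+ 4 by rewrite -normrX ger0_norm// exprn_even_ge0.
  by rewrite lerXn2r ?nnegrE// (le_trans _ wB).
Qed.

Lemma almost_gaussian_vector (D : nat) (B e : R) : 0 < e ->
  exists (W : finType) (G : W -> nat -> R), (0 < #|W|)%N /\
    forall w : nat -> R, (forall i, `|w i| <= B) ->
      `|favg (fun a => cos (\sum_(i < D) w i * G a i))
        - expR (- ((\sum_(i < D) w i ^+ 2) / 2))| <= e.
Proof.
move=> e0.
(* Each of the [D] coordinates gets an equal share of the error; [D.+1] keeps the share defined when
   [D] is 0. *)
have e'0 : 0 < e / D.+1%:R by rewrite divr_gt0.
have [W [G [phi [W0 hG phi1 hphi]]]] := almost_gaussian B e'0.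
have [V [H [V0 hH]]] := iid_copies D W0 hG.
exists V, H; split=> // w wB.
have := hH 0 w; rewrite cos0 mul1r.
under eq_favg do rewrite add0r.
move=> ->.
rewrite mulr_suml -sumrN expR_sum.
have := @dist_prod_le R D (fun i => phi (w i)) (fun i => expR (- (w i ^+ 2 / 2)))
  (e / D.+1%:R) (fun i => phi1 _) _ (fun i => hphi _ (wB i)).
have h (i : nat) : `|expR (- (w i ^+ 2 / 2))| <= 1.
  by rewrite ger0_norm ?expR_ge0// expR_le1 oppr_le0 divr_ge0// sqr_ge0.
move=> /(_ h) /le_trans; apply.
by rewrite mulrA ler_pdivrMr// mulrC ler_pM2l// ler_nat.
Qed.

End almost_gaussian.

(** * Correlations of the wave and randomized rounding to signs *)

Section features.
Context {R : realType}.
Implicit Types (c t x y : R).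

(* The coefficients approximate 2 / sqrt 3 and 2 / (6 sqrt 3): the third
   harmonic leaves room, under [wave_le1], for a first harmonic of size > 1. *)
Definition wave t : R := 23 / 20 * sin t + 19 / 100 * sin (3 * t).

Lemma sin3 t : sin (3 * t) = 3 * sin t - 4 * sin t ^+ 3.
Proof.
have -> : 3 * t = t + t + t by ring.
rewrite !sinD cosD.
have := cos2Dsin2 t.
set s := sin t; set k := cos t => h.
have h2 : k * k = 1 - s ^+ 2 by rewrite -expr2; lra.
rewrite [X in X = _](_ : _ = 3 * s * (k * k) - s ^+ 3); last by ring.
by rewrite h2; ring.
Qed.

(** In terms of s = sin t the wave is 43/25 s - 19/25 s^3, with critical points near -87/100 and
    87/100; squares centred there certify the bound. *)
Lemma wave_le1 t : `|wave t| <= 1.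
Proof.
rewrite /wave sin3; have := sin_geN1 t; have := sin_le1 t.
move: (sin t) => s s1 s2; rewrite !exprS expr0 ler_norml; apply/andP; split.
  have h : 0 <= (s + 1) * (s + 87 / 100) ^+ 2 by rewrite mulr_ge0 ?sqr_ge0//; lra.
  have h2 : 0 <= (s + 87 / 100) ^+ 2 by rewrite sqr_ge0.
  move: h h2; rewrite !exprS expr0; nra.
have h : 0 <= (1 - s) * (87 / 100 - s) ^+ 2 by rewrite mulr_ge0 ?sqr_ge0//; lra.
have h2 : 0 <= (87 / 100 - s) ^+ 2 by rewrite sqr_ge0.
move: h h2; rewrite !exprS expr0; nra.
Qed.

(* The expectation of sin (j X) sin (k Y) for standard Gaussians X, Y of
   covariance c. *)
Definition sin_corr (j k c : R) : R :=
  (expR (- ((j ^+ 2 + k ^+ 2) / 2 - j * k * c))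
   - expR (- ((j ^+ 2 + k ^+ 2) / 2 + j * k * c))) / 2.

(** The expectation of [wave X * wave Y] for standard Gaussians [X], [Y] of covariance [c], expanded
    bilinearly. *)
Definition wave_corr c : R :=
  (23 / 20) ^+ 2 * sin_corr 1 1 c + (23 / 20 * (19 / 100)) * sin_corr 1 3 c
  + (23 / 20 * (19 / 100)) * sin_corr 3 1 c + (19 / 100) ^+ 2 * sin_corr 3 3 c.

Lemma sin_corrE (j k c : R) : sin_corr j k c =
  expR (- ((j ^+ 2 + k ^+ 2) / 2)) * ((expR (j * k * c) - expR (- (j * k * c))) / 2).
Proof.
rewrite /sin_corr !opprD opprK !expRD; ring.
Qed.

Lemma sin_corr_ndecr (j k x y : R) : 0 <= j * k -> y <= x ->
  sin_corr j k y <= sin_corr j k x.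
Proof.
move=> jk yx; rewrite !sin_corrE ler_pM2l ?expR_gt0// ler_pM2r ?invr_gt0//.
by rewrite lerB// ler_expR ?lerN2 ler_wpM2l.
Qed.

(** All four terms are nondecreasing, and the first alone has slope at least (23/20)^2 * 365/1000 >
    12/25. This is where a first harmonic larger than 1 pays off. *)
Lemma wave_corr_incr x y : y <= x ->
  12 / 25 * (x - y) <= wave_corr x - wave_corr y.
Proof.
move=> yx; rewrite /wave_corr.
have := @sin_corr_ndecr 1 3 x y; have := @sin_corr_ndecr 3 1 x y.
have := @sin_corr_ndecr 3 3 x y; rewrite !mul1r !mulr1.
have h9 : 0 <= 3 * 3 :> R by lra.
have h3 : 0 <= 3 :> R by lra.
move=> /(_ h9 yx) h33 /(_ h3 yx) h31 /(_ h3 yx) h13.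
have h11 : 365 / 1000 * (x - y) <= sin_corr 1 1 x - sin_corr 1 1 y.
  rewrite !sin_corrE !mul1r expr1n.
  have -> : (1 + 1) / 2 = 1 :> R by lra.
  have := sinh_increment yx; have := @expRN1_ge R.
  set E := expR (- 1); set X := expR x - _; set Y := expR y - _.
  move=> *; nra.
rewrite expr2; nra.
Qed.

(** The inverse has to accept every real [x], because averages of sign products may leave the range
    of [wave_corr] on [-1, 1]. *)
Lemma wave_corr_inverse : exists g : R -> R, forall x c, `|c| <= 1 ->
  12 / 25 * `|g x - c| <= `|wave_corr c - x|.
Proof.
(* The point -1 keeps this set nonempty when [x] lies below that range. *)
pose A x := [set c | c = -1 \/ (`|c| <= 1 /\ wave_corr c <= x)].
have A1 x : ubound (A x) 1.
  by move=> c [->|[+ _]]; [lra|rewrite ler_norml => /andP[]].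
have A0 x : has_sup (A x) by split; [exists (-1); left|exists 1; exact: A1].
exists (fun x => sup (A x)) => x c c1.
set D := `|_ - x|.
have D0 : 0 <= D by exact: normr_ge0.
have /andP[Dge Dle] : - D <= wave_corr c - x <= D by rewrite -ler_norml.
move: (c1); rewrite ler_norml => /andP[c_ge c_le].
rewrite leNgt; apply/negP; case: (ltrP c (sup (A x))) => [cg|gc].
  move=> h.
  have : c + 25 / 12 * D < sup (A x) by lra.
  move=> /(sup_gt (A0 x).1) [d [->|[]]]; first by lra.
  rewrite ler_norml => /andP[d_ge d_le] Fd cd.
  have : c <= d by lra.
  by move=> /wave_corr_incr; lra.
move=> h.
pose d := c - 25 / 12 * D.
have gd : sup (A x) < d by rewrite /d; lra.
have g1 : -1 <= sup (A x) by apply: sup_upper_bound => //; left.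
have Fd : x < wave_corr d.
  rewrite ltNge; apply/negP => Fd.
  suff : d <= sup (A x) by lra.
  apply: sup_upper_bound => //; right; split => //.
  by rewrite ler_norml; apply/andP; split; rewrite /d in gd *; lra.
have : d <= c by rewrite /d; lra.
by move=> /wave_corr_incr; rewrite /d in Fd *; lra.
Qed.

(** The product-to-sum formula turns each product of sines into cosines of linear forms in [G], with
    variances j^2 + k^2 - 2jkc and j^2 + k^2 + 2jkc. *)
Lemma prod_sin_favg (D : nat) (e : R) : 0 < e ->
  exists (W : finType) (G : W -> nat -> R), (0 < #|W|)%N /\
    forall u v : nat -> R, (forall i, `|u i| <= 1) -> (forall i, `|v i| <= 1) ->
      \sum_(i < D) u i ^+ 2 = 1 -> \sum_(i < D) v i ^+ 2 = 1 ->
      `|favg (fun a => wave (\sum_(i < D) u i * G a i) *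
                       wave (\sum_(i < D) v i * G a i))
        - wave_corr (\sum_(i < D) u i * v i)| <= e.
Proof.
(* The four correlations carry total weight (23/20 + 19/100)^2 < 2, so each may err by [e / 2]. The
   bound 6 = 3 + 3 covers coordinates for frequencies up to 3. *)
move=> e0; have e20 : 0 < e / 2 by rewrite divr_gt0.
have [W [G [W0 hG]]] := almost_gaussian_vector D 6 e20.
exists W, G; split=> // u v u1 v1 su sv.
set c := \sum_(i < D) u i * v i.
pose X a := \sum_(i < D) u i * G a i; pose Y a := \sum_(i < D) v i * G a i.
have corr (j k : R) : `|j| <= 3 -> `|k| <= 3 ->
    `|favg (fun a => sin (j * X a) * sin (k * Y a)) - sin_corr j k c| <= e / 2.
  move=> j3 k3.
  have lin (s : R) a : j * X a + s * k * Y a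
      = \sum_(i < D) (j * u i + s * k * v i) * G a i.
    rewrite /X /Y !mulr_sumr -big_split/=; apply: eq_bigr => i _; ring.
  have sq (s : R) : s ^+ 2 = 1 -> \sum_(i < D) (j * u i + s * k * v i) ^+ 2
      = j ^+ 2 + k ^+ 2 + 2 * s * (j * k * c).
    move=> s2.
    transitivity (\sum_(i < D) (j ^+ 2 * u i ^+ 2 + k ^+ 2 * v i ^+ 2
                   + 2 * s * j * k * (u i * v i))).
      apply: eq_bigr => i _.
      transitivity (j ^+ 2 * u i ^+ 2 + s ^+ 2 * k ^+ 2 * v i ^+ 2
                   + 2 * s * j * k * (u i * v i)); first by ring.
      by rewrite s2; ring.
    by rewrite !big_split/= -!mulr_sumr su sv /c; ring.
  have bnd (s : R) : `|s| = 1 -> forall i, `|j * u i + s * k * v i| <= 6.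
    move=> s1 i; rewrite (le_trans (ler_normD _ _))// !normrM s1 mul1r.
    have -> : 6 = 3 * 1 + 3 * 1 :> R by ring.
    by rewrite lerD// ler_pM.
  have hm := hG (fun i => j * u i + (- 1) * k * v i) (bnd _ _).
  have hp := hG (fun i => j * u i + 1 * k * v i) (bnd _ _).
  move: (hm (normrN1 _)) (hp (normr1 _)) => {hm hp}.
  rewrite !sq ?expr1n ?sqrrN ?expr1n//.
  under eq_favg do rewrite -lin mulN1r mulNr -[_ - _]/(_ - _).
  under [in X in _ -> X -> _]eq_favg do rewrite -lin mul1r.
  have -> : favg (fun a => sin (j * X a) * sin (k * Y a)) =
     2^-1 * favg (fun a => cos (j * X a - k * Y a)) +
     (- 2^-1) * favg (fun a => cos (j * X a + k * Y a)).
    rewrite -!favgZ -favgD; apply: eq_favg => a.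
    by rewrite cosB cosD; field.
  rewrite /sin_corr.
  have -> : (j ^+ 2 + k ^+ 2 + 2 * - 1 * (j * k * c)) / 2 =
    (j ^+ 2 + k ^+ 2) / 2 - j * k * c by field.
  have -> : (j ^+ 2 + k ^+ 2 + 2 * 1 * (j * k * c)) / 2 =
    (j ^+ 2 + k ^+ 2) / 2 + j * k * c by field.
  by rewrite !ler_norml => /andP[? ?] /andP[? ?]; apply/andP; split; lra.
have -> : favg (fun a => wave (X a) * wave (Y a)) =
   (23 / 20) ^+ 2 * favg (fun a => sin (1 * X a) * sin (1 * Y a))
   + (23 / 20 * (19 / 100)) * favg (fun a => sin (1 * X a) * sin (3 * Y a))
   + (23 / 20 * (19 / 100)) * favg (fun a => sin (3 * X a) * sin (1 * Y a))
   + (19 / 100) ^+ 2 * favg (fun a => sin (3 * X a) * sin (3 * Y a)).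
  by rewrite -!favgZ -!favgD; apply: eq_favg => a; rewrite /wave !mul1r; ring.
have n1 : `|1| <= 3 :> R by rewrite normr1; lra.
have n3 : `|3| <= 3 :> R by rewrite ger0_norm.
move: (corr 1 1 n1 n1) (corr 1 3 n1 n3) (corr 3 1 n3 n1) (corr 3 3 n3 n3).
rewrite /wave_corr !ler_norml.
move=> /andP[? ?] /andP[? ?] /andP[? ?] /andP[? ?]; rewrite !expr2.
by apply/andP; split; lra.
Qed.

(** The sum is the ceiling of [z]. *)
Lemma count_lt_bounds (M : nat) (z : R) : 0 <= z -> z <= M%:R ->
  z <= \sum_(l < M) (if (l%:R < z) then 1 else 0) <= z + 1.
Proof.
elim: M => [|M IHM] z0 zM; first by rewrite big_ord0; apply/andP; split; lra.
rewrite big_ord_recr/=; case: (lerP z M%:R) => [zM'|Mz].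
  by rewrite addr0 IHM.
rewrite (eq_bigr (fun=> 1)); last first.
  by move=> l _; rewrite (lt_le_trans _ (ltW Mz))// ltr_nat.
by rewrite sumr_const card_ord natr1 zM -natr1 lerD2r ltW.
Qed.

(** A uniform threshold yields the sign 1 with probability about (1 + y) / 2, hence mean about [y];
    the error comes from the grid. *)
Lemma favg_threshold (M : nat) y : `|y| <= 1 ->
  `|favg (fun l : 'I_M.+1 => bsign (l%:R < M.+1%:R * (1 + y) / 2)) - y|
    <= 2 / M.+1%:R.
Proof.
rewrite ler_norml => /andP[y1 y2].
have M0 : 0 < M.+1%:R :> R by [].
set z := M.+1%:R * (1 + y) / 2.
have z0 : 0 <= z by rewrite /z divr_ge0// mulr_ge0//; lra.
have zM : z <= M.+1%:R.
  by rewrite /z ler_pdivrMr// ler_pM2l//; lra.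
have /andP[h1 h2] := count_lt_bounds z0 zM.
have -> : favg (fun l : 'I_M.+1 => bsign (l%:R < z)) =
  2 / M.+1%:R * (\sum_(l < M.+1) (if (l%:R < z) then 1 else 0)) - 1 :> R.
  transitivity (favg (fun l : 'I_M.+1 =>
      2 * (if (l%:R < z) then 1 else 0) + - 1 : R)).
    by apply: eq_favg => l; rewrite /bsign; case: ifP => _; ring.
  by rewrite favgD favgZ favg_cst ?card_ord// /favg card_ord; ring.
have yE : y = 2 / M.+1%:R * z - 1 by rewrite /z; field; rewrite gt_eqF.
set s := \sum_(l < _) _ in h1 h2 *.
have -> : 2 / M.+1%:R * s - 1 - y = 2 / M.+1%:R * (s - z).
  by rewrite {1}yE; ring.
rewrite normrM ger0_norm ?divr_ge0// -[leRHS]mulr1 ler_wpM2l ?divr_ge0//.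
by rewrite ler_norml; apply/andP; split; lra.
Qed.

Lemma bsign_norm b : `|bsign b : R| = 1.
Proof. by rewrite /bsign; case: b; rewrite ?normrN1 ?normr1. Qed.

(* [p a < wave _] and [q a < wave _] are one-bit roundings with independent
   thresholds, so their product has the expectation of the product of the two
   waves even when both are evaluated at the same point. *)
Lemma one_bit_features (D : nat) (e : R) : 0 < e ->
  exists (W : finType) (G : W -> nat -> R) (p q : W -> R), (0 < #|W|)%N /\
    forall u v : nat -> R, (forall i, `|u i| <= 1) -> (forall i, `|v i| <= 1) ->
      \sum_(i < D) u i ^+ 2 = 1 -> \sum_(i < D) v i ^+ 2 = 1 ->
      `|favg (fun a => bsign (p a < wave (\sum_(i < D) u i * G a i)) *
                       bsign (q a < wave (\sum_(i < D) v i * G a i)))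
        - wave_corr (\sum_(i < D) u i * v i)| <= e.
Proof.
move=> e0; have e20 : 0 < e / 2 by rewrite divr_gt0.
have [W [G [W0 hG]]] := prod_sin_favg D e20.
(* Two roundings cost [2 / M.+1%:R] each, together at most [e / 2]. *)
pose M := Num.trunc (8 / e); have M0 : 0 < M.+1%:R :> R by [].
have hM : 4 / M.+1%:R <= e / 2.
  have : 8 / e < M.+1%:R by exact: truncnS_gt.
  rewrite ltr_pdivrMr// => h; rewrite ler_pdivrMr//; lra.
pose thr (l : 'I_M.+1) : R := 2 * l%:R / M.+1%:R - 1.
have thrE l y : (thr l < y) = (l%:R < M.+1%:R * (1 + y) / 2).
  rewrite /thr ltrBlDl ltr_pdivrMr// ltr_pdivlMr//.
  by rewrite [2 * _]mulrC [M.+1%:R * _]mulrC.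
exists (W * ('I_M.+1 * 'I_M.+1))%type, (fun a => G a.1),
  (fun a => thr a.2.1), (fun a => thr a.2.2).
split; first by rewrite !card_prod !card_ord !muln_gt0 W0.
move=> u v u1 v1 su sv.
pose X a := wave (\sum_(i < D) u i * G a i).
pose Y a := wave (\sum_(i < D) v i * G a i).
rewrite (favg_pair (fun a (b : 'I_M.+1 * 'I_M.+1) =>
  bsign (thr b.1 < X a) * bsign (thr b.2 < Y a))).
pose r y : R := favg (fun l => bsign (thr l < y)).
have -> : favg (fun a => favg (fun b : 'I_M.+1 * 'I_M.+1 =>
    bsign (thr b.1 < X a) * bsign (thr b.2 < Y a))) =
  favg (fun a => r (X a) * r (Y a)) :> R.
  apply: eq_favg => a.
  rewrite (favg_pair (fun l l' => bsign (thr l < X a) * bsign (thr l' < Y a))).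
  rewrite mulrC -favgZ; apply: eq_favg => l.
  by rewrite favgZ mulrC.
have rX y : `|y| <= 1 -> `|r y - y| <= 2 / M.+1%:R.
  move=> y1; rewrite /r; under eq_favg do rewrite thrE.
  exact: favg_threshold.
have r1 y : `|r y| <= 1.
  by rewrite /r favg_norm_le ?card_ord// => l; rewrite bsign_norm.
have h1 : `|favg (fun a => r (X a) * r (Y a)) - favg (fun a => X a * Y a)| <= e / 2.
  rewrite -[X in _ - X]mul1r -mulNr -favgZ -favgD favg_norm_le// => a.
  have -> : r (X a) * r (Y a) + -1 * (X a * Y a)
    = r (X a) * (r (Y a) - Y a) + (r (X a) - X a) * Y a by ring.
  rewrite (le_trans (ler_normD _ _))// (le_trans _ hM)//.
  have -> : 4 / M.+1%:R = 1 * (2 / M.+1%:R) + (2 / M.+1%:R) * 1 :> R.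
    by field; rewrite gt_eqF.
  rewrite lerD// normrM ler_pM//; by [exact: r1|exact/rX/wave_le1|exact: wave_le1].
have := hG u v u1 v1 su sv; rewrite -/(X _) -/(Y _) => h2.
move: h1 h2; rewrite /X /Y !ler_norml.
by move=> /andP[? ?] /andP[? ?]; apply/andP; split; lra.
Qed.

Lemma measurable_fun_wave : measurable_fun [set: R] wave.
Proof.
have ms : measurable_fun [set: R] (@sin R).
  apply: continuous_measurable_fun => t; exact: continuous_sin.
rewrite /wave; apply: measurable_funD; apply: measurable_funM => //.
by apply: (measurableT_comp ms); exact: measurable_funM.
Qed.

Lemma measurable_wave_corr : measurable_fun [set: R] wave_corr.
Proof.
apply: nondecreasing_measurable => // x y xy.
by have := wave_corr_incr xy; lra.
Qed.

End features.

(** * Greedy selection in L^2 *)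

Section bounded_measurable.
Context d (S : measurableType d) (R : realType).
Implicit Types f g : S -> R.

(** A class closed under the algebra operations and integrable for every probability measure, which
    settles all integrability conditions. *)
Definition bmeas f :=
  measurable_fun [set: S] f /\ exists B, forall x, `|f x| <= B.

Lemma bmeas_cst c : bmeas (fun=> c).
Proof. by split; [exact: measurable_cst|exists `|c|]. Qed.

Lemma bmeasD f g : bmeas f -> bmeas g -> bmeas (fun x => f x + g x).
Proof.
move=> [mf [A fA]] [mg [B gB]]; split; first exact: measurable_funD.
by exists (A + B) => x; rewrite (le_trans (ler_normD _ _))// lerD.
Qed.

Lemma bmeasM f g : bmeas f -> bmeas g -> bmeas (fun x => f x * g x).
Proof.
move=> [mf [A fA]] [mg [B gB]]; split; first exact: measurable_funM.
by exists (A * B) => x; rewrite normrM ler_pM.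
Qed.

Lemma bmeasZ c f : bmeas f -> bmeas (fun x => c * f x).
Proof. by move=> ?; apply: bmeasM => //; exact: bmeas_cst. Qed.

Lemma bmeasB f g : bmeas f -> bmeas g -> bmeas (fun x => f x - g x).
Proof.
move=> bf /(bmeasZ (-1)) bg.
rewrite (_ : (fun x => _) = (fun x => f x + -1 * g x)); first exact: bmeasD.
by apply/funext => x; rewrite mulN1r.
Qed.

Lemma bmeas_sqr f : bmeas f -> bmeas (fun x => f x ^+ 2).
Proof.
move=> bf; rewrite (_ : (fun x => _) = (fun x => f x * f x)).
  exact: bmeasM.
by apply/funext => x; rewrite expr2.
Qed.

Lemma bmeas_sum (I : Type) (s : seq I) (f : I -> S -> R) :
  (forall i, bmeas (f i)) -> bmeas (fun x => \sum_(i <- s) f i x).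
Proof.
move=> bf; elim: s => [|i s IHs].
  rewrite (_ : (fun x => _) = fun=> 0); first exact: bmeas_cst.
  by apply/funext => x; rewrite big_nil.
rewrite (_ : (fun x => _) = fun x => f i x + \sum_(j <- s) f j x).
  exact: bmeasD.
by apply/funext => x; rewrite big_cons.
Qed.

End bounded_measurable.

Section expectation.
Context d (S : measurableType d) (R : realType).
Variable nu : {measure set S -> \bar R}.
Hypothesis nu1 : nu [set: S] = 1%E.
Implicit Types f g : S -> R.
Local Notation E f := (Rintegral nu [set: S] f).

Lemma bmeas_integrable f : bmeas f -> nu.-integrable [set: S] (EFin \o f).
Proof.
move=> [mf [B fB]]; apply: measurable_bounded_integrable => //.
  by rewrite nu1 ltry.
exists B; split; first by rewrite num_real.
by move=> y By x _; rewrite /= (le_trans (fB x))// ltW.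
Qed.

Lemma RintegralTD f g : bmeas f -> bmeas g ->
  E (fun x => f x + g x) = E f + E g.
Proof. by move=> bf bg; rewrite RintegralD//; exact: bmeas_integrable. Qed.

Lemma RintegralTZ c f : bmeas f -> E (fun x => c * f x) = c * E f.
Proof. by move=> bf; rewrite RintegralZl//; exact: bmeas_integrable. Qed.

Lemma RintegralT_cst c : E (fun=> c) = c.
Proof. by rewrite Rintegral_cst// nu1/= mulr1. Qed.

Lemma le_RintegralT f g : bmeas f -> bmeas g -> (forall x, f x <= g x) ->
  E f <= E g.
Proof. by move=> bf bg fg; apply: le_Rintegral => //; exact: bmeas_integrable. Qed.

Lemma RintegralT_sum (I : Type) (s : seq I) (f : I -> S -> R) :
  (forall i, bmeas (f i)) ->
  E (fun x => \sum_(i <- s) f i x) = \sum_(i <- s) E (f i).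
Proof.
move=> bf; elim: s => [|i s IHs].
  rewrite big_nil -[RHS]RintegralT_cst; congr (E _).
  by apply/funext => x; rewrite big_nil.
rewrite big_cons -IHs -RintegralTD//; last exact: bmeas_sum.
by congr (E _); apply/funext => x; rewrite big_cons.
Qed.

Lemma RintegralT_favg (W : finType) (f : W -> S -> R) :
  (forall a, bmeas (f a)) ->
  E (fun x => favg (f ^~ x)) = favg (fun a => E (f a)).
Proof.
move=> bf; rewrite /favg -RintegralT_sum// mulrC -RintegralTZ; last first.
  exact: bmeas_sum.
by congr (E _); apply/funext => x; rewrite mulrC.
Qed.

Lemma le_favg_exists (W : finType) (f : W -> R) : (0 < #|W|)%N ->
  exists a, f a <= favg f.
Proof.
move=> W0; apply: contrapT => /forallNP h.
have /card_gt0P[a0 _] := W0.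
have : favg f *+ #|W| < \sum_a f a.
  rewrite -sumr_const; apply: ltr_sum.
    by apply/hasP; exists a0 => //; rewrite mem_index_enum.
  by move=> a _; rewrite ltNge; apply/negP/h.
rewrite -mulr_natr /favg divfK ?ltxx//.
by rewrite pnatr_eq0 -lt0n.
Qed.

(** [P] is the error accumulated so far. On average over [a] the new term is nearly uncorrelated
    with it, and some [a] does no worse than the average. *)
Lemma greedy_step (W : finType) (s : W -> S -> R) (F P : S -> R) (e B : R) :
  (0 < #|W|)%N -> (forall a, bmeas (s a)) -> bmeas F -> bmeas P ->
  (forall a x, `|s a x| = 1) -> (forall x, `|P x| <= B) ->
  (forall x, `|favg (s ^~ x) - F x| <= e) ->
  exists a, E (fun x => (P x + (s a x - F x)) ^+ 2)
            <= E (fun x => P x ^+ 2) + (1 + e ^+ 2 + 2 * (B * e)).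
Proof.
move=> W0 bs bF bP s1 PB sF.
have bt a : bmeas (fun x => (P x + (s a x - F x)) ^+ 2).
  by apply: bmeas_sqr; apply: bmeasD => //; exact: bmeasB.
have [a ha] := le_favg_exists (fun a => E (fun x => (P x + (s a x - F x)) ^+ 2)) W0.
exists a; apply: (le_trans ha).
rewrite -RintegralT_favg// -[X in _ + X]RintegralT_cst -RintegralTD; last 2 first.
- exact: bmeas_sqr.
- exact: bmeas_cst.
apply: le_RintegralT.
- rewrite (_ : (fun x => favg _) =
     fun x => (#|W|%:R)^-1 * \sum_a (P x + (s a x - F x)) ^+ 2); last first.
    by apply/funext => x; rewrite mulrC.
  by apply: bmeasZ; exact: bmeas_sum.
- by apply: bmeasD; [exact: bmeas_sqr|exact: bmeas_cst].
move=> x.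
have -> : favg (fun a => (P x + (s a x - F x)) ^+ 2) =
    favg (fun a => ((P x - F x) ^+ 2 + 1) + 2 * (P x - F x) * s a x).
  apply: eq_favg => b.
  have : s b x ^+ 2 = 1 by rewrite -[LHS]ger0_norm ?sqr_ge0// normrX s1 expr1n.
  move=> h; transitivity ((P x - F x) ^+ 2 + s b x ^+ 2
    + 2 * (P x - F x) * s b x); first by ring.
  by rewrite h.
rewrite favgD favgZ favg_cst//.
move: (sF x) (PB x); set q := favg _; set b := q - F x => be Pb.
have -> : q = F x + b by rewrite /b; ring.
have h1 : P x * b <= B * e.
  by rewrite (le_trans (ler_norm _))// normrM ler_pM.
have h2 : b ^+ 2 <= e ^+ 2.
  rewrite -[b ^+ 2]ger0_norm ?sqr_ge0// normrX.
  by rewrite lerXn2r ?nnegrE// (le_trans _ be).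
(* The average equals P^2 + 1 + 2Pb + b^2 - (F + b)^2; the last square is discarded. *)
have := sqr_ge0 (F x + b); move: h1 h2; rewrite !expr2; lra.
Qed.

(** Each step adds about 1 to the squared norm of the sum, so dividing the sum by [m] leaves an L^2
    error near m^(-1/2). *)
Lemma greedy_approx (W : finType) (s : W -> S -> R) (F : S -> R) (e : R) (m : nat) :
  (0 < #|W|)%N -> (forall a, bmeas (s a)) -> bmeas F -> 0 <= e ->
  (forall a x, `|s a x| = 1) -> (forall x, `|favg (s ^~ x) - F x| <= e) ->
  exists w : nat -> W,
    E (fun x => (\sum_(j < m) (s (w j) x - F x)) ^+ 2)
    <= m%:R * (1 + e ^+ 2 + 2 * (m%:R * (2 + e) * e)).
Proof.
move=> W0 bs bF e0 s1 sF.
have F2 x : `|F x| <= 1 + e.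
  have -> : F x = favg (s ^~ x) - (favg (s ^~ x) - F x) by ring.
  rewrite (le_trans (ler_normB _ _))// lerD// favg_norm_le// => a.
  by rewrite s1.
have bsum (w : nat -> W) (n : nat) : bmeas (fun x => \sum_(j < n) (s (w j) x - F x)).
  by apply: bmeas_sum => j; exact: bmeasB.
suff H k : (k <= m)%N -> exists w : nat -> W,
    E (fun x => (\sum_(j < k) (s (w j) x - F x)) ^+ 2)
    <= k%:R * (1 + e ^+ 2 + 2 * (m%:R * (2 + e) * e)) by exact: H.
elim: k => [_|k IHk km].
  have /card_gt0P[a0 _] := W0.
  exists (fun=> a0); rewrite mul0r.
  rewrite (_ : (fun x => _) = fun=> 0) ?RintegralT_cst//.
  by apply/funext => x; rewrite big_ord0 expr0n.
have [w hw] := IHk (ltnW km).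
(* This crude bound suffices because it enters only multiplied by [e]. *)
have PB x : `|\sum_(j < k) (s (w j) x - F x)| <= m%:R * (2 + e).
  rewrite (le_trans (ler_norm_sum _ _ _))//.
  rewrite (le_trans (ler_sum _ (_ : forall j : 'I_k, true -> _ <= 2 + e)))//.
    move=> j _; rewrite (le_trans (ler_normB _ _))// s1.
    by have := F2 x; lra.
  rewrite sumr_const card_ord -[_ *+ k]mulr_natl ler_wpM2r ?ler_nat ?(ltnW km)//; lra.
have [a ha] := greedy_step W0 bs bF (bsum w k) s1 PB sF.
exists (fun j => if j == k then a else w j).
rewrite (_ : (fun x => _) =
    fun x => (\sum_(j < k) (s (w j) x - F x) + (s a x - F x)) ^+ 2); last first.
  apply/funext => x; rewrite big_ord_recr/= eqxx; congr ((_ + _) ^+ 2).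
  by apply: eq_bigr => j _; rewrite (ltn_eqF (ltn_ord j)).
by rewrite (le_trans ha)// -[k.+1%:R]natr1 [leRHS]mulrDl mul1r lerD2r.
Qed.

End expectation.

(** * Positive definite kernels *)

Section kernels.
Context (R : realType) (T : Type).
Implicit Types (K : T * T -> R) (x y t : T).

Definition psd_kernel K :=
  (forall s t, K (s, t) = K (t, s)) /\
  forall m (t : 'I_m -> T) (v : 'I_m -> R),
    0 <= \sum_i \sum_j v i * v j * K (t i, t j).

Lemma positive_definite_psd K : positive_definite_kernel K -> psd_kernel K.
Proof.
move=> [symK pdK]; split=> // -[|m] t v; first by rewrite big_ord0.
have [_ /(_ (\col_i v i))] := pdK m.+1 t isT.
congr (0 <= _); rewrite mxE [RHS]exchange_big; apply: eq_bigr => j _.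
rewrite !mxE mulr_suml; apply: eq_bigr => i _; rewrite !mxE; ring.
Qed.

Section psd_kernel_theory.
Variable K : T * T -> R.
Hypothesis psdK : psd_kernel K.

Lemma psd_kernel2 (a b : R) x y :
  0 <= a ^+ 2 * K (x, x) + 2 * a * b * K (x, y) + b ^+ 2 * K (y, y).
Proof.
have [symK pdK] := psdK.
have := pdK 2%N (fun i => if i == ord0 then x else y)
  (fun i => if i == ord0 then a else b).
rewrite !big_ord_recl !big_ord0/= [K (y, x)]symK; congr (0 <= _).
by ring.
Qed.

Lemma psd_kernel_diag_ge0 x : 0 <= K (x, x).
Proof. by have := psd_kernel2 1 0 x x; rewrite !expr2; lra. Qed.

Lemma psd_kernel_CS x y : K (x, y) ^+ 2 <= K (x, x) * K (y, y).
Proof.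
(* This vector gives the claim multiplied by [K (y, y)]; the next one forces [K (x, y)] to vanish
   when [K (y, y)] is 0. *)
have := psd_kernel2 (K (y, y)) (- K (x, y)) x y.
have := psd_kernel2 (K (x, y)) (- (K (x, x) + 1)) x y.
have := psd_kernel_diag_ge0 x; have := psd_kernel_diag_ge0 y.
move: (K (x, x)) (K (x, y)) (K (y, y)) => a b c c0 a0.
case: (eqVneq c 0) => [-> h _|cn0 _ h].
  have : 0 <= b ^+ 2 by exact: sqr_ge0.
  rewrite mulr0; move: h; rewrite !expr2 => h b2.
  have : b * b * (a + 2) <= 0 by nra.
  by rewrite pmulr_lle0//; lra.
have {}c0 : 0 < c by rewrite lt_def cn0.
rewrite -subr_ge0 -(pmulr_rge0 _ c0).
by move: h; congr (0 <= _); ring.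
Qed.

Lemma psd_kernel_bounded : (forall t, K (t, t) <= 1) -> forall z, `|K z| <= 1.
Proof.
move=> K1 [x y]; rewrite -(ler_pXn2r (n := 2))// ?nnegrE//.
rewrite expr1n real_normK ?num_real// (le_trans (psd_kernel_CS x y))//.
by rewrite mulr_ile1// psd_kernel_diag_ge0.
Qed.

(** The column of the Cholesky factor obtained by pivoting at [t]. *)
Definition pivot t x := K (x, t) / Num.sqrt (K (t, t)).

(** A Schur complement: adjoining the point [t] with the minimising weight [- q / K (t, t)] turns
    the form of [K] into that of the residual. *)
Lemma psd_kernel_residual t : 0 < K (t, t) ->
  psd_kernel (fun z => K z - pivot t z.1 * pivot t z.2).
Proof.
have [symK pdK] := psdK; move=> Kt0; split.
  by move=> x y /=; rewrite symK mulrC.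
move=> m s v /=.
have sK : Num.sqrt (K (t, t)) ^+ 2 = K (t, t) by rewrite sqr_sqrtr// ltW.
have sn0 : Num.sqrt (K (t, t)) != 0 by rewrite gt_eqF// sqrtr_gt0.
set q := \sum_i v i * K (s i, t).
have := pdK m.+1 (fun i => oapp s t (unlift ord0 i))
  (fun i => oapp v (- q / K (t, t)) (unlift ord0 i)).
rewrite big_ord_recl big_ord_recl unlift_none/=.
under eq_bigr do rewrite liftK/= symK.
under [X in _ + X]eq_bigr.
  move=> i _; rewrite big_ord_recl unlift_none liftK/=.
  under eq_bigr do rewrite liftK/=.
  over.
rewrite big_split/=.
have -> : \sum_i - q / K (t, t) * v i * K (s i, t) = - q / K (t, t) * q.
  by rewrite /q mulr_sumr; apply: eq_bigr => i _; rewrite mulrA.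
have -> : \sum_i v i * (- q / K (t, t)) * K (s i, t) = - q / K (t, t) * q.
  by rewrite /q mulr_sumr; apply: eq_bigr => i _; ring.
have -> : \sum_i \sum_j v i * v j * (K (s i, s j) - pivot t (s i) * pivot t (s j))
  = \sum_i \sum_j v i * v j * K (s i, s j) - q ^+ 2 / K (t, t).
  transitivity (\sum_i \sum_j v i * v j * K (s i, s j) -
    \sum_i \sum_j (v i * K (s i, t)) * (v j * K (s j, t)) / K (t, t)).
    rewrite -sumrB; apply: eq_bigr => i _; rewrite -sumrB; apply: eq_bigr => j _.
    by rewrite /pivot -{3}sK; field.
  congr (_ - _); rewrite expr2 -mulrA [RHS]mulr_suml; apply: eq_bigr => i _.
  by rewrite /q mulr_suml mulr_sumr; apply: eq_bigr => j _; rewrite !mulrA.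
by congr (0 <= _); field; rewrite gt_eqF.
Qed.

End psd_kernel_theory.
End kernels.

(** * Finite-rank approximation of a kernel in L^2 *)

Section pivoted_cholesky.
Context (R : realType) (d : measure_display) (T : measurableType d).
Variable mu : probability T R.
Local Notation nu := (mu \x mu)%E.

Lemma product_probability_setT : nu [set: T * T] = 1%E.
Proof.
rewrite -setXTT product_measure1E// -[RHS]mule1.
by congr (_ * _)%E; exact: probability_setT.
Qed.

Lemma bmeas_pair (f g : T -> R) : bmeas f -> bmeas g ->
  bmeas (fun z : T * T => f z.1 * g z.2).
Proof.
move=> [mf [A fA]] [mg [B gB]]; apply: bmeasM; split.
- exact: (measurableT_comp mf measurable_fst).
- by exists A => z.
- exact: (measurableT_comp mg measurable_snd).
- by exists B => z.
Qed.

Lemma bmeas_section (f : T * T -> R) t : bmeas f -> bmeas (fun x => f (x, t)).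
Proof.
move=> [mf [A fA]]; split; last by exists A => x.
exact: measurable_fun_pair1.
Qed.

Lemma bmeas_diag (f : T * T -> R) : bmeas f -> bmeas (fun x => f (x, x)).
Proof.
move=> [mf [A fA]]; split; last by exists A => x.
apply: (measurableT_comp mf).
by apply: measurable_fun_pair; exact: measurable_id.
Qed.

(** By Tonelli the double integral is the mean of the section integrals, so they cannot all be at
    most [c]. *)
Lemma section_gt (f : T * T -> R) (c : R) : bmeas f -> (forall z, 0 <= f z) ->
  c < Rintegral nu setT f -> exists t, c < Rintegral mu setT (fun x => f (x, t)).
Proof.
move=> bf f0; apply: contraPP => /forallNP h; apply/negP; rewrite -leNgt.
have {}h t : Rintegral mu setT (fun x => f (x, t)) <= c.
  by rewrite leNgt; apply/negP.
have intf := bmeas_integrable product_probability_setT bf.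
rewrite -lee_fin /Rintegral fineK; last exact: integrable_fin_num.
have mf : measurable_fun [set: T * T] (EFin \o f) by apply/measurable_EFinP; case: bf.
have Ef0 z : (0 <= (EFin \o f) z)%E by rewrite lee_fin.
rewrite (fubini_tonelli2 (EFin \o f) mf Ef0).
have -> : c%:E = (\int[mu]_y c%:E)%E.
  rewrite integral_cst// -[LHS]mule1; congr (_ * _)%E.
  exact/esym/probability_setT.
apply: ge0_le_integral => //.
- by move=> y _; apply: integral_ge0 => x _; rewrite lee_fin.
- by apply: measurable_fun_fubini_tonelli_G => // z; rewrite lee_fin.
move=> y _; rewrite /fubini_G/=.
have inty := bmeas_integrable (probability_setT mu) (bmeas_section y bf).
by have := h y; rewrite -lee_fin /Rintegral fineK//; exact: integrable_fin_num.
Qed.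

(** Pivot at a [t] whose column has large norm. Cauchy-Schwarz excludes [K (t, t) = 0], and
    normalising by [K (t, t) <= 1] only enlarges the column. *)
Lemma cholesky_step (c : R) (K : T * T -> R) :
  bmeas K -> psd_kernel K -> (forall t, K (t, t) <= 1) -> 0 <= c ->
  c < Rintegral nu setT (fun z => K z ^+ 2) ->
  exists e : T -> R, [/\ bmeas e, psd_kernel (fun z => K z - e z.1 * e z.2) &
    c < Rintegral mu setT (fun x => e x ^+ 2)].
Proof.
move=> bK psdK K1 c0 /(section_gt (bmeas_sqr bK) (fun=> sqr_ge0 _))[t /= ht].
have bKt : bmeas (fun x => K (x, t)) by exact: bmeas_section.
have Kt0 : 0 < K (t, t).
  rewrite lt_def psd_kernel_diag_ge0// andbT; apply/eqP => Ktt.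
  suff : c < 0 by lra.
  rewrite (lt_le_trans ht)// -[leRHS](RintegralT_cst (probability_setT mu) 0).
  apply: (le_RintegralT (probability_setT mu)).
  - exact: bmeas_sqr.
  - exact: bmeas_cst.
  - by move=> x; have := psd_kernel_CS psdK x t; rewrite Ktt mulr0.
have be : bmeas (pivot K t).
  rewrite (_ : pivot K t = fun x => (Num.sqrt (K (t, t)))^-1 * K (x, t)).
    exact: bmeasZ.
  by apply/funext => x; rewrite mulrC.
exists (pivot K t); split=> //; first exact: psd_kernel_residual.
rewrite (lt_le_trans ht)//; apply: (le_RintegralT (probability_setT mu)).
- exact: bmeas_sqr.
- exact: bmeas_sqr.
move=> x; rewrite /pivot exprMn exprVn sqr_sqrtr ?(ltW Kt0)//.
by rewrite ler_peMr ?sqr_ge0// invf_ge1.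
Qed.

(* Each step with a large residual lowers the trace by more than [c], so at
   most [M] steps are needed. *)
Lemma pivoted_cholesky (c : R) (M : nat) (K : T * T -> R) : 0 <= c ->
  measurable_fun [set: T * T] K -> psd_kernel K -> (forall t, K (t, t) <= 1) ->
  Rintegral mu setT (fun t => K (t, t)) <= M%:R * c ->
  exists (n : nat) (e : nat -> T -> R), [/\ forall i, bmeas (e i),
    forall x, \sum_(i < n) e i x ^+ 2 <= K (x, x) &
    Rintegral nu setT (fun z => (K z - \sum_(i < n) e i z.1 * e i z.2) ^+ 2) <= c].
Proof.
move=> c0; elim: M K => [|M IHM] K mK psdK K1 trK;
    have bK : bmeas K by split => //; exists 1; exact: psd_kernel_bounded.
  exists 0%N, (fun _ _ => 0); split=> [i|x|].
  - exact: bmeas_cst.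
  - by rewrite big_ord0 psd_kernel_diag_ge0.
  rewrite (_ : (fun z => _) = fun z => K z ^+ 2); last first.
    by apply/funext => z; rewrite big_ord0 subr0.
  (* The trace is now at most 0, while one more step would extract more than [c >= 0] from it. *)
  rewrite leNgt; apply/negP => /(cholesky_step bK psdK K1 c0)[e [be psdK' he]].
  have : Rintegral mu setT (fun x => e x ^+ 2)
      <= Rintegral mu setT (fun x => K (x, x)).
    apply: (le_RintegralT (probability_setT mu)).
    - exact: bmeas_sqr.
    - exact: bmeas_diag.
    by move=> x; have := psd_kernel_diag_ge0 psdK' x; rewrite /= subr_ge0 -expr2.
  by move: trK; rewrite mul0r; lra.
have [small|] := lerP (Rintegral nu setT (fun z => K z ^+ 2)) c.
  exists 0%N, (fun _ _ => 0); split=> [i|x|].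
  - exact: bmeas_cst.
  - by rewrite big_ord0 psd_kernel_diag_ge0.
  rewrite (_ : (fun z => _) = fun z => K z ^+ 2)//.
  by apply/funext => z; rewrite big_ord0 subr0.
move=> /(cholesky_step bK psdK K1 c0)[e [be psdK' he]].
have bK' : bmeas (fun z => K z - e z.1 * e z.2).
  by apply: bmeasB => //; exact: bmeas_pair.
have [||n [f [bf fK fc]]] := IHM _ bK'.1 psdK'.
- by move=> t /=; have := K1 t; have := sqr_ge0 (e t); rewrite expr2; lra.
- rewrite /= (_ : (fun t => _) = fun t => K (t, t) + -1 * e t ^+ 2); last first.
    by apply/funext => t; rewrite expr2 mulN1r.
  have pT := probability_setT mu.
  rewrite (RintegralTD pT) ?(RintegralTZ pT); first last.
  - by apply: bmeasZ; exact: bmeas_sqr.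
  - exact: bmeas_diag.
  - exact: bmeas_sqr.
  by move: trK; rewrite -natr1 mulrDl mul1r; lra.
exists n.+1, (fun i => if i == n then e else f i); split=> [i|x|].
- by case: ifP.
- rewrite big_ord_recr/= eqxx.
  under eq_bigr => i _ do rewrite (ltn_eqF (ltn_ord i)).
  by have := fK x; rewrite /= -expr2; lra.
rewrite (_ : (fun z => _) =
  fun z => (K z - e z.1 * e z.2 - \sum_(i < n) f i z.1 * f i z.2) ^+ 2)//.
apply/funext => z; rewrite big_ord_recr/= eqxx; congr (_ ^+ 2).
under eq_bigr => i _ do rewrite (ltn_eqF (ltn_ord i)).
by rewrite opprD addrA addrAC.
Qed.

End pivoted_cholesky.

(** * Partitions and block averages *)

Section finite_codes.
Context d (S : measurableType d) (R : realType).

(** A finite partition is encoded by a labelling of points whose fibres are the blocks. *)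
Definition measurable_code (C : finType) (f : S -> C) :=
  forall v, measurable (f @^-1` [set v]).

Lemma bmeas_code (C : finType) (f : S -> C) (h : C -> R) :
  measurable_code f -> bmeas (fun x => h (f x)).
Proof.
move=> mf.
rewrite (_ : (fun x => _) = fun x => \sum_v h v * \1_(f @^-1` [set v]) x).
  apply: bmeas_sum => v; apply: bmeasZ; split; first exact: measurable_indic.
  by exists 1 => x; rewrite indicE normr_nat; case: (_ \in _).
apply/funext => x; rewrite (bigD1 (f x))//= big1 => [|v vfx].
  by rewrite addr0 indicE mem_set ?mulr1.
by rewrite indicE memNset ?mulr0// => /esym/eqP; exact/negP.
Qed.

Lemma measurable_code_bool (b : S -> bool) :
  measurable_fun [set: S] b -> measurable_code b.
Proof. by move=> mb v; rewrite -[X in measurable X]setTI; exact: mb. Qed.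

Lemma measurable_code_ffun (J C : finType) (f : J -> S -> C) :
  (forall j, measurable_code (f j)) ->
  measurable_code (fun x => [ffun j => f j x]).
Proof.
move=> mf v; rewrite (_ : _ @^-1` _ =
    \bigcap_(j in [set: J]) (f j @^-1` [set v j])).
  by apply: fin_bigcap_measurable => // j _; exact: mf.
apply/seteqP; split=> [x /= <- j _|x /= h]; first by rewrite /= ffunE.
by apply/ffunP => j; rewrite ffunE; exact: h.
Qed.

Lemma measurable_code_prod (C D : finType) (f : S -> C) (g : S -> D) :
  measurable_code f -> measurable_code g ->
  measurable_code (fun x => (f x, g x)).
Proof.
move=> mf mg [v w]; rewrite (_ : _ @^-1` _ = f @^-1` [set v] `&` g @^-1` [set w]).
  exact: measurableI.
by apply/seteqP; split=> x /= [-> ->].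
Qed.

End finite_codes.

(** * Optimality of block averages *)

Section block_averages.
Context d (S : measurableType d) (R : realType).
Variable nu : {measure set S -> \bar R}.
Hypothesis nu1 : nu [set: S] = 1%E.
Local Notation E f := (Rintegral nu [set: S] f).

Lemma Rintegral_setI_indic (A : set S) (f : S -> R) :
  Rintegral nu A f = E (fun x => \1_A x * f x).
Proof.
rewrite Rintegral_mkcond; congr (E _); apply/funext => x.
by rewrite patchE indicE; case: ifPn => _; rewrite ?mul1r ?mul0r.
Qed.

(** Pythagoras: the error of the averages is orthogonal to every function of the code. The averaging
    hypothesis is stated without division, so it also makes sense on null blocks. *)
Lemma block_average_best (C : finType) (f : S -> C) (K : S -> R) (L0 L1 : C -> R) :
  measurable_code f -> bmeas K ->
  (forall v, Rintegral nu (f @^-1` [set v]) K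
             = L1 v * fine (nu (f @^-1` [set v]))) ->
  E (fun x => (K x - L1 (f x)) ^+ 2) <= E (fun x => (K x - L0 (f x)) ^+ 2).
Proof.
move=> mf bK hL1.
have bind v : bmeas (\1_(f @^-1` [set v]) : S -> R).
  split; first exact: measurable_indic.
  by exists 1 => x; rewrite indicE normr_nat; case: (_ \in _).
have bL (h : C -> R) : bmeas (fun x => h (f x)) by exact: bmeas_code.
pose D v := L1 v - L0 v.
have bX : bmeas (fun x => D (f x) * (K x - L1 (f x))).
  by apply: bmeasM; [exact: (bL D)|exact: bmeasB].
have cross : E (fun x => D (f x) * (K x - L1 (f x))) = 0.
  rewrite (_ : (fun x => _) = fun x => \sum_v D v *
      (\1_(f @^-1` [set v]) x * K x + (- L1 v) * \1_(f @^-1` [set v]) x)).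
    rewrite RintegralT_sum//.
      apply: big1 => v _; rewrite RintegralTZ//; last first.
        by apply: bmeasD; [exact: bmeasM|exact: bmeasZ].
      rewrite RintegralTD//; [|exact: bmeasM|exact: bmeasZ].
      rewrite RintegralTZ// -Rintegral_setI_indic hL1.
      have -> : E (\1_(f @^-1` [set v])) = fine (nu (f @^-1` [set v])).
        rewrite -[RHS]mul1r -Rintegral_cst// [RHS]Rintegral_setI_indic.
        by congr (E _); apply/funext => x; rewrite mulr1.
      by rewrite mulNr subrr mulr0.
    by move=> v; apply: bmeasZ; apply: bmeasD; [exact: bmeasM|exact: bmeasZ].
  apply/funext => x; rewrite (bigD1 (f x))//= big1 => [|v vfx].
    by rewrite addr0 indicE mem_set// mul1r mulr1.
  by rewrite indicE memNset ?mul0r ?mulr0 ?addr0 ?mulr0// => /esym/eqP; exact/negP.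
rewrite [leRHS](_ : _ = E (fun x => (K x - L1 (f x)) ^+ 2 + D (f x) ^+ 2)
    + 2 * E (fun x => D (f x) * (K x - L1 (f x)))).
  rewrite cross mulr0 addr0; apply: le_RintegralT => //.
  - by apply: bmeas_sqr; exact: bmeasB.
  - by apply: bmeasD; [apply: bmeas_sqr; exact: bmeasB|exact/bmeas_sqr/(bL D)].
  - by move=> x; rewrite lerDl sqr_ge0.
rewrite -RintegralTZ// -RintegralTD//.
- by congr (E _); apply/funext => x; rewrite /D; ring.
- by apply: bmeasD; [apply: bmeas_sqr; exact: bmeasB|exact/bmeas_sqr/(bL D)].
- exact: bmeasZ.
Qed.

Lemma Lnorm2_le (f : S -> R) (c : R) : bmeas f -> 0 <= c ->
  E (fun x => f x ^+ 2) <= c ^+ 2 -> ('N[nu]_2%:E[EFin \o f] <= c%:E)%E.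
Proof.
move=> bf c0 fc; rewrite unlock.
rewrite (_ : (\int[nu]_x _)%E = (E (fun x => f x ^+ 2))%:E); last first.
  rewrite /Rintegral fineK; last first.
    by apply: integrable_fin_num => //; exact/bmeas_integrable/bmeas_sqr.
  apply: eq_integral => x _ /=.
  by rewrite powR_mulrn// real_normK ?num_real.
rewrite poweR_EFin lee_fin powR12_sqrt; last first.
  by apply: Rintegral_ge0 => x _; exact: sqr_ge0.
rewrite -(ler_sqr (sqrtr_ge0 _) c0)// sqr_sqrtr// Rintegral_ge0// => x _.
exact: sqr_ge0.
Qed.

End block_averages.

Lemma measurable_code_pair d (T : measurableType d) (C D : finType)
    (f : T -> C) (g : T -> D) :
  measurable_code f -> measurable_code g ->
  measurable_code (fun z : T * T => (f z.1, g z.2)).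
Proof.
move=> mf mg [v w].
rewrite (_ : _ @^-1` _ = (f @^-1` [set v]) `*` (g @^-1` [set w])).
  exact: measurableX.
by apply/seteqP; split=> z /= [-> ->].
Qed.

Lemma unit_coord (R : realType) (D : nat) (u : nat -> R) (i : nat) :
  \sum_(j < D) u j ^+ 2 = 1 -> (i < D)%N -> `|u i| <= 1.
Proof.
move=> u1 iD; rewrite -(ler_pXn2r (n := 2))// ?nnegrE// expr1n.
rewrite real_normK ?num_real// -u1 (bigD1 (Ordinal iD))//= lerDl.
by apply: sumr_ge0 => j _; exact: sqr_ge0.
Qed.

(** * Coding points by [r] bits *)

Section kernel_partition.
Context (R : realType) (d : measure_display) (T : measurableType d).
Variable mu : probability T R.
Local Notation nu := (mu \x mu)%E.
Let nuT := product_probability_setT mu.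

Lemma kernel_code (K : T * T -> R) (r : nat) : (9 < r)%N ->
  measurable_fun [set: T * T] K -> psd_kernel K -> (forall t, K (t, t) <= 1) ->
  exists (C : finType) (c : T -> C) (L : C * C -> R), [/\ (#|C| <= 2 ^ r)%N,
    measurable_code c &
    Rintegral nu setT (fun z => (K z - L (c z.1, c z.2)) ^+ 2) <= pi ^+ 2 / r%:R].
Proof.
move=> r9 mK psdK K1.
have bK : bmeas K by split=> //; exists 1; exact: psd_kernel_bounded.
pose m := r./2.
have m_gt0 : (0 < m)%N by rewrite /m; lia.
(* For r > 9 the ratio r / m is largest at r = 11. *)
have rm : (5 * r <= 11 * m)%N by rewrite /m; lia.
have rR0 : 0 < r%:R :> R by rewrite ltr0n; lia.
have mR0 : 0 < m%:R :> R by rewrite ltr0n.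
(* Chosen so that the finite-rank error, weighted by 401 below, costs at most 1/(100 r). *)
pose dlt : R := (401 * (100 * r%:R))^-1.
have dlt0 : 0 < dlt by rewrite invr_gt0; lra.
have [n [e [be eK hKn]]] : exists (n : nat) (e : nat -> T -> R),
    [/\ forall i, bmeas (e i),
    forall x, \sum_(i < n) e i x ^+ 2 <= K (x, x) &
    Rintegral nu setT (fun z => (K z - \sum_(i < n) e i z.1 * e i z.2) ^+ 2) <= dlt].
  (* The trace is at most 1, which [M.+1] steps of size [dlt] exhaust. *)
  pose M := Num.trunc dlt^-1.
  apply: (@pivoted_cholesky R d T mu dlt M.+1) => //; first exact: ltW.
  apply: (@le_trans _ _ 1).
    rewrite -[leRHS](RintegralT_cst (probability_setT mu) 1).
    apply: (le_RintegralT (probability_setT mu)) => //; first exact: bmeas_diag.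
    exact: bmeas_cst.
  by rewrite -ler_pdivrMr// mul1r ltW// truncnS_gt.
pose Kn z : R := \sum_(i < n) e i z.1 * e i z.2.
have bKn : bmeas Kn by apply: bmeas_sum => i; exact: bmeas_pair.
have e1 x : \sum_(i < n) e i x ^+ 2 <= 1 by exact: le_trans (eK x) (K1 x).
have Kn1 z : `|Kn z| <= 1.
  rewrite (le_trans (ler_norm_sum _ _ _))//.
  apply: (@le_trans _ _ (\sum_(i < n) (e i z.1 ^+ 2 + e i z.2 ^+ 2) / 2)).
    apply: ler_sum => i _; rewrite ler_norml.
    have := sqr_ge0 (e i z.1 + e i z.2); have := sqr_ge0 (e i z.1 - e i z.2).
    by rewrite !expr2 => *; apply/andP; split; lra.
  by rewrite -mulr_suml big_split/=; have := e1 z.1; have := e1 z.2; lra.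
pose h x := Num.sqrt (1 - \sum_(i < n) e i x ^+ 2).
have h2 x : h x ^+ 2 = 1 - \sum_(i < n) e i x ^+ 2.
  by rewrite sqr_sqrtr// subr_ge0.
(* The extra coordinates of [u] and [v] make both unit vectors without
   changing their inner products, even on the diagonal. *)
pose u x i := if (i < n)%N then e i x else if i == n then h x else 0.
pose v x i := if (i < n)%N then e i x else if i == n.+1 then h x else 0.
have ultn x (i : 'I_n) : u x i = e i x by rewrite /u ltn_ord.
have vltn x (i : 'I_n) : v x i = e i x by rewrite /v ltn_ord.
have un x : u x n = h x by rewrite /u ltnn eqxx.
have vn x : v x n = 0 by rewrite /v ltnn ltn_eqF.
have un1 x : u x n.+1 = 0 by rewrite /u ltnNge leqnSn/= gtn_eqF.
have vn1 x : v x n.+1 = h x by rewrite /v ltnNge leqnSn/= eqxx.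
have su x : \sum_(i < n.+2) u x i ^+ 2 = 1.
  rewrite 2!big_ord_recr/= un un1 h2; under eq_bigr do rewrite ultn.
  by ring.
have sv x : \sum_(i < n.+2) v x i ^+ 2 = 1.
  rewrite 2!big_ord_recr/= vn vn1 h2; under eq_bigr do rewrite vltn.
  by ring.
have suv x y : \sum_(i < n.+2) u x i * v y i = Kn (x, y).
  rewrite 2!big_ord_recr/= un1 vn mulr0 mul0r !addr0.
  by apply: eq_bigr => i _; rewrite ultn vltn.
have u1 x i : `|u x i| <= 1.
  have [iD|Di] := ltnP i n.+2; first exact: unit_coord (su x) iD.
  by rewrite /u !ifF ?normr0//; lia.
have v1 x i : `|v x i| <= 1.
  have [iD|Di] := ltnP i n.+2; first exact: unit_coord (sv x) iD.
  by rewrite /v !ifF ?normr0//; lia.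
have me i : measurable_fun [set: T] (e i) by case: (be i).
have mh : measurable_fun [set: T] h.
  apply: (measurableT_comp (f := @Num.sqrt R)).
    by apply: continuous_measurable_fun; exact: sqrt_continuous.
  apply: measurable_funB => //; apply: measurable_sum => i.
  exact: measurable_funX.
have mu_ i : measurable_fun [set: T] (u ^~ i) 
  by rewrite /u; case: (i < n)%N => //; case: (i == n).
have mv i : measurable_fun [set: T] (v ^~ i) 
  by rewrite /v; case: (i < n)%N => //; case: (i == n.+1).
(* With [m%:R * eta] equal to 1/2000, the factor in the greedy bound stays below 401/400. *)
pose eta : R := (40 * (50 * m%:R))^-1.
have eta0 : 0 < eta by rewrite invr_gt0; lra.
have [W [G [p [q [W0 hW]]]]] := one_bit_features n.+2 eta0.
pose cu (a : W) x := p a < wave (\sum_(i < n.+2) u x i * G a i).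
pose cv (a : W) x := q a < wave (\sum_(i < n.+2) v x i * G a i).
have mcu a : measurable_code (cu a).
  apply: measurable_code_bool; apply: measurable_fun_ltr => //.
  apply: (measurableT_comp (@measurable_fun_wave R)).
  by apply: measurable_sum => i; exact: measurable_funM.
have mcv a : measurable_code (cv a).
  apply: measurable_code_bool; apply: measurable_fun_ltr => //.
  apply: (measurableT_comp (@measurable_fun_wave R)).
  by apply: measurable_sum => i; exact: measurable_funM.
pose s a z : R := bsign (cu a z.1) * bsign (cv a z.2).
have bs a : bmeas (s a).
  exact: (bmeas_pair (bmeas_code bsign (mcu a)) (bmeas_code bsign (mcv a))).
have s1 a z : `|s a z| = 1 by rewrite normrM !bsign_norm mulr1.
pose F z := wave_corr (Kn z).
have sF z : `|favg (s ^~ z) - F z| <= eta.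
  have := hW (u z.1) (v z.2) (u1 _) (v1 _) (su _) (sv _).
  by rewrite suv -surjective_pairing.
have bF : bmeas F.
  split; first by apply: (measurableT_comp (@measurable_wave_corr R)); case: bKn.
  exists (1 + eta) => z.
  have -> : F z = favg (s ^~ z) - (favg (s ^~ z) - F z) by ring.
  rewrite (le_trans (ler_normB _ _))// lerD// favg_norm_le// => a.
  by rewrite s1.
have [w hw] := greedy_approx nuT m W0 bs bF (ltW eta0) s1 sF.
have [g hg] := @wave_corr_inverse R.
(* A point stores its signs both as a row and as a column, since one partition serves both
   variables. *)
pose C : finType := ({ffun 'I_m -> bool} * {ffun 'I_m -> bool})%type.
pose c x : C := ([ffun j : 'I_m => cu (w j) x], [ffun j : 'I_m => cv (w j) x]).
pose L (ab : C * C) : R :=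
  g ((\sum_(j < m) bsign (ab.1.1 j) * bsign (ab.2.2 j)) / m%:R).
have mc : measurable_code c.
  by apply: measurable_code_prod; apply: measurable_code_ffun => j.
exists C, c, L; split=> //.
  rewrite card_prod card_ffun card_bool card_ord -expnD leq_exp2l// /m; lia.
pose A z : R := (\sum_(j < m) s (w j) z) / m%:R.
have LE z : L (c z.1, c z.2) = g (A z).
  by rewrite /L /A /=; congr (g (_ / _)); apply: eq_bigr => j _; rewrite !ffunE.
have bL : bmeas (fun z => L (c z.1, c z.2)).
  exact: (bmeas_code L (measurable_code_pair mc mc)).
have bsum : bmeas (fun z => \sum_(j < m) (s (w j) z - F z)).
  by apply: bmeas_sum => j; exact: bmeasB.
(* Weighted inequality (a - b)^2 <= 401 a^2 + 401/400 b^2: the finite-rank error [a] can be made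
   tiny, so nearly no loss falls on [b]. *)
have pointwise z : (K z - L (c z.1, c z.2)) ^+ 2 <=
    401 * (K z - Kn z) ^+ 2 +
    401 / 400 * (25 / 12) ^+ 2 / m%:R ^+ 2 * (\sum_(j < m) (s (w j) z - F z)) ^+ 2.
  rewrite LE.
  have hgz := hg (A z) (Kn z) (Kn1 z).
  have sE : \sum_(j < m) (s (w j) z - F z) = m%:R * (A z - F z).
    rewrite sumrB sumr_const card_ord /A -mulr_natl.
    by field; rewrite gt_eqF.
  rewrite sE [(m%:R * _) ^+ 2]exprMn.
  have -> : 401 / 400 * (25 / 12) ^+ 2 / m%:R ^+ 2 * (m%:R ^+ 2 * (A z - F z) ^+ 2)
    = 401 / 400 * ((25 / 12) ^+ 2 * (F z - A z) ^+ 2).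
    by field; rewrite gt_eqF.
  set a := K z - Kn z; set b := g (A z) - Kn z in hgz.
  have -> : K z - g (A z) = a - b by rewrite /a /b; ring.
  have hb : b ^+ 2 <= (25 / 12) ^+ 2 * (F z - A z) ^+ 2.
    rewrite -exprMn -[b ^+ 2]real_normK ?num_real// -[leRHS]real_normK ?num_real//.
    rewrite lerXn2r ?nnegrE// normrM [`|25 / 12|]ger0_norm ?divr_ge0//.
    by rewrite -/(F z) in hgz; lra.
  have := sqr_ge0 (a + b / 400).
  have := hb; rewrite !expr2; lra.
apply: (le_trans (le_RintegralT nuT _ _ pointwise)).
- by apply: bmeas_sqr; exact: bmeasB.
- apply: bmeasD; apply: bmeasZ; apply: bmeas_sqr => //; exact: bmeasB.
rewrite (RintegralTD nuT); first last.
- by apply: bmeasZ; exact: bmeas_sqr.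
- by apply: bmeasZ; apply: bmeas_sqr; exact: bmeasB.
rewrite !(RintegralTZ nuT); first last.
- by apply: bmeas_sqr; exact: bmeasB.
- exact: bmeas_sqr.
set I1 := Rintegral _ _ _ in hKn *; set I2 := Rintegral _ _ _ in hw *.
have heta : 1 + eta ^+ 2 + 2 * (m%:R * (2 + eta) * eta) <= 401 / 400.
  have meta : m%:R * eta = (40^-1 * 50^-1) by rewrite /eta; field; rewrite gt_eqF.
  have eta_le : eta <= (40^-1 * 50^-1).
    by rewrite -meta ler_peMl ?ler1n ?ltW.
  have -> : 2 * (m%:R * (2 + eta) * eta) = 2 * (2 + eta) * (m%:R * eta) by ring.
  by rewrite meta expr2; nra.
(* Numerically (401/400)^2 (25/12)^2 (11/5) < 96/10. *)
have hI2 : 401 / 400 * (25 / 12) ^+ 2 / m%:R ^+ 2 * I2 <= 96 / 10 / r%:R.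
  have : I2 <= m%:R * (401 / 400) by rewrite (le_trans hw)// ler_wpM2l// ltW.
  move=> hI.
  apply: (@le_trans _ _ (401 / 400 * (25 / 12) ^+ 2 / m%:R ^+ 2 * (m%:R * (401 / 400)))).
    apply: (ler_wpM2l _ hI); apply: divr_ge0; last exact: sqr_ge0.
    by apply: mulr_ge0; [lra|exact: sqr_ge0].
  have mr : (m%:R)^-1 <= 11 / 5 / r%:R :> R.
    rewrite ler_pdivlMr// mulrC ler_pdivrMr//.
    have : (5 * r)%:R <= (11 * m)%:R :> R by rewrite ler_nat.
    by rewrite !natrM; lra.
  have -> : 401 / 400 * (25 / 12) ^+ 2 / m%:R ^+ 2 * (m%:R * (401 / 400))
    = (401 / 400) ^+ 2 * (25 / 12) ^+ 2 * (m%:R)^-1 :> R.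
    by field; rewrite gt_eqF.
  move: mr; have : 0 < (r%:R)^-1 :> R by rewrite invr_gt0.
  move: (m%:R^-1) (r%:R^-1) => x y y0 xy; rewrite !expr2; lra.
have hI1 : 401 * I1 <= 1 / 100 / r%:R.
  apply: (@le_trans _ _ (401 * dlt)); first by apply: (ler_wpM2l _ hKn); lra.
  rewrite le_eqVlt; apply/orP; left; apply/eqP; rewrite /dlt.
  by field; rewrite gt_eqF.
(* 96/10 + 1/100 = (31/10)^2, which is at most pi^2. *)
apply: (@le_trans _ _ (961 / 100 / r%:R)); first by lra.
rewrite ler_pM2r ?invr_gt0//.
by have := @pi_ge31 R; rewrite expr2; nra.
Qed.

End kernel_partition.

(** * The partition into fibres of a code *)

Section fibre_partition.
Context (T : Type) (C : finType) (c : T -> C).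

(** Only attained codes index blocks, because the blocks of a [partition] are nonempty. *)
Definition code_range : {set C} := [set v | `[< exists x, c x = v >]]%SET.

Definition fibre (i : 'I_#|code_range|) : set T := c @^-1` [set enum_val i].

Lemma fibre_exists x : exists2 i, setT i & fibre i x.
Proof.
have cx : c x \in code_range by rewrite inE; apply/asboolP; exists x.
by exists (enum_rank_in cx (c x)) => //; rewrite /fibre/= enum_rankK_in.
Qed.

Lemma partition_fibre : partition [set: 'I_#|code_range|] fibre [set: T].
Proof.
split.
- by apply/seteqP; split=> // x _; have [i _ ?] := fibre_exists x; exists i.
- move=> i j _ _ [x [xi xj]]; apply: enum_val_inj.
  by rewrite /fibre/= in xi xj; rewrite -xi -xj.
- by move=> i _; have := enum_valP i; rewrite inE => /asboolP[x cx]; exists x.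
Qed.

End fibre_partition.

(** * Averaging over products of fibres *)

Section fibre_averages.
Context (R : realType) (d : measure_display) (T : measurableType d).
Variables (mu : probability T R) (C : finType) (c : T -> C) (K : T * T -> R).
Hypothesis mc : measurable_code c.
Hypothesis bK : bmeas K.
Local Notation nu := (mu \x mu)%E.
Local Notation I := (@fibre T C c).
Let nuT := product_probability_setT mu.

Let F (v : C * C) : set (T * T) := (c @^-1` [set v.1]) `*` (c @^-1` [set v.2]).

Lemma averages_on_fibres_exists :
  exists L, block_constant I L /\ averages_on_blocks mu I K L.
Proof.
(* On null blocks the division by 0 gives the value 0. *)
exists (fun z => Rintegral nu (F (c z.1, c z.2)) K /
  fine (mu (c @^-1` [set c z.1]) * mu (c @^-1` [set c z.2]))%E).
split=> i j; first by eexists => z [/= -> ->].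
by move=> _ z [/= zi zj]; rewrite /F/= zi zj.
Qed.

Lemma averages_on_fibres_best (L : T * T -> R) (L0 : C * C -> R) :
  block_constant I L -> averages_on_blocks mu I K L ->
  bmeas (fun z => K z - L z) /\
  Rintegral nu setT (fun z => (K z - L z) ^+ 2)
    <= Rintegral nu setT (fun z => (K z - L0 (c z.1, c z.2)) ^+ 2).
Proof.
move=> cL aL.
have [L1 hL1] : exists L1 : C * C -> R, forall z, L z = L1 (c z.1, c z.2).
  have /choice[L1 hL1] (v : C * C) : exists a : R, forall z, F v z -> L z = a.
    case: (pselect (F v !=set0)) => [[[x y] [/= xv yv]]|v0]; last first.
      (* A default value for pairs of codes that are not attained. *)
      by exists 0 => z Fz; case: v0; exists z.
    have [i _ ix] := fibre_exists c x; have [j _ jy] := fibre_exists c y.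
    have [a ha] := cL i j; exists a => z [/= zx zy]; apply: ha.
    by rewrite /fibre/= in ix jy; split; rewrite /fibre/= ?zx ?zy -?xv -?yv.
  by exists L1 => z; apply: hL1.
have mcc := measurable_code_pair mc mc.
have -> : L = fun z => L1 (c z.1, c z.2) by apply/funext.
split; first by apply: bmeasB => //; exact: (bmeas_code L1 mcc).
apply: (block_average_best nuT L0 mcc bK) => v.
have -> : (fun z : T * T => (c z.1, c z.2)) @^-1` [set v] = F v.
  by case: v => a b; rewrite /F; apply/seteqP; split=> z /= [-> ->].
have nuF : nu (F v) = (mu (c @^-1` [set v.1]) * mu (c @^-1` [set v.2]))%E.
  by rewrite product_measure1E//; exact: mc.
have mF : measurable (F v) by apply: measurableX; exact: mc.
(* On a null block both sides vanish, whatever value [L] takes there. *)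
have [nuF0|] := eqVneq (nu (F v)) 0%E.
  transitivity (0 : R); last first.
    rewrite -[LHS](mulr0 (L1 v)); congr (_ * _).
    exact: esym (congr1 fine nuF0).
  rewrite /Rintegral null_set_integral//.
  by apply: measurable_funTS; apply/measurable_EFinP; case: bK.
rewrite -measure_gt0 => nuF0.
have muF0 : (0 < mu (c @^-1` [set v.1]) * mu (c @^-1` [set v.2]))%E.
  by rewrite -nuF; exact: nuF0.
case: (pselect (F v !=set0)) => [[[x y] Fxy]|Fv]; last first.
  have Fv0 : F v = set0 by apply: contrapT => /eqP/set0P.
  by move: muF0; rewrite -nuF Fv0 measure0 ltxx.
have [i _ ix] := fibre_exists c x; have [j _ jy] := fibre_exists c y.
have [/= cx cy] := Fxy.
have Ii : I i = c @^-1` [set v.1] by rewrite -cx /fibre; move: ix => /= ->.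
have Ij : I j = c @^-1` [set v.2] by rewrite -cy /fibre; move: jy => /= ->.
have := aL i j; rewrite Ii Ij => /(_ muF0 (x, y) Fxy).
rewrite hL1/= cx cy -surjective_pairing => ->.
rewrite -mulrA -[LHS]mulr1; congr (_ * _); apply/esym.
apply: etrans (congr1 (fun t => _ * fine t) nuF) _; rewrite mulVf// gt_eqF//.
by rewrite fine_gt0// muF0/= ltey_eq fin_numM// fin_num_measure//; exact: mc.
Qed.

End fibre_averages.

Theorem theorem5p6 (R : realType) (d : measure_display) (T : measurableType d)
    (mu : probability T R) (K : T * T -> R)
    (mK : measurable_fun [set: T * T] K)
    (pdK : positive_definite_kernel K)
    (K_le1 : forall t : T, K (t, t) <= 1)
    (r : nat) (r_gt0 : (0 < r)%N) :
  exists (k : nat) (I : 'I_k -> set T),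
    [/\ (k <= 2 ^ r)%N,
        forall i : 'I_k, measurable (I i),
        partition [set: 'I_k] I [set: T],
        exists L : T * T -> R,
          [/\ block_constant I L,
              averages_on_blocks mu I K L &
              ('N[mu \x mu]_2%:E[EFin \o (K \- L)%R]
                 <= (pi / Num.sqrt r%:R)%:E)%E]
      & forall L : T * T -> R,
          block_constant I L -> averages_on_blocks mu I K L ->
          ('N[mu \x mu]_2%:E[EFin \o (K \- L)%R]
             <= (pi / Num.sqrt r%:R)%:E)%E].
Proof.
have psdK := positive_definite_psd pdK.
have K1 := psd_kernel_bounded psdK K_le1.
have bK : bmeas K by split=> //; exists 1.
have nuT := product_probability_setT mu.
have rR0 : 0 < r%:R :> R by rewrite ltr0n.
have [C [c [L0 [Cr mc hL0]]]] : exists (C : finType) (c : T -> C)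
    (L : C * C -> R), [/\ (#|C| <= 2 ^ r)%N, measurable_code c &
    Rintegral (mu \x mu)%E setT (fun z => (K z - L (c z.1, c z.2)) ^+ 2)
      <= pi ^+ 2 / r%:R].
  have [r9|r9] := ltnP 9 r; first exact: kernel_code.
  (* One block and the zero function: the squared error is at most 1, and r <= 9 < (31/10)^2 <=
     pi^2. *)
  exists unit, (fun=> tt), (fun=> 0); split.
  - by rewrite card_unit expn_gt0.
  - by move=> []; rewrite (_ : _ @^-1` _ = setT)//; apply/seteqP; split.
  apply: (@le_trans _ _ 1).
    rewrite -[leRHS](RintegralT_cst nuT); apply: (le_RintegralT nuT).
    - by apply: bmeas_sqr; apply: bmeasB => //; exact: bmeas_cst.
    - exact: bmeas_cst.
    - by move=> z; rewrite subr0 -real_normK ?num_real// exprn_ile1.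
  rewrite ler_pdivlMr// mul1r.
  have : r%:R <= 9%:R :> R by rewrite ler_nat.
  by have := @pi_ge31 R; rewrite expr2; nra.
(* Proved for every averaged [L], this yields both the existence clause and the universal one. *)
have best L : block_constant (@fibre T C c) L ->
    averages_on_blocks mu (@fibre T C c) K L ->
    ('N[mu \x mu]_2%:E[EFin \o (K \- L)%R] <= (pi / Num.sqrt r%:R)%:E)%E.
  move=> cL aL; have [bL hL] := averages_on_fibres_best mc bK L0 cL aL.
  apply: (Lnorm2_le nuT bL); first by rewrite divr_ge0 ?pi_ge0.
  by rewrite exprMn exprVn sqr_sqrtr ?(ltW rR0)// (le_trans hL).
exists #|code_range c|, (@fibre T C c); split=> //.
- by rewrite (leq_trans (max_card _)).
- by move=> i; exact: mc.
- exact: partition_fibre.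
- have [L [cL aL]] := averages_on_fibres_exists mu c K.
  by exists L; split=> //; exact: best.
Qed.
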